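(* For every $f\in C(\mathbb{CP}^1)$ and every positive integer $n$, $$\lim_{\nu\to\infty}\big\|(\nu+1)^nR_\nu\big(R_\nu^*(f)^n\big)-f^n\big\|_\infty=0.$$
   Context: For an integer $\nu\ge0$, $\mathcal{H}_\nu$ is the space of polynomials in one complex variable of degree $\le\nu$, with inner product $\langle f,g\rangle=\int_{\mathbb{C}}f\overline g\,d\iota_\nu$, $d\iota_\nu(z)=\frac{\nu+1}{(1+|z|^2)^\nu}\frac{dA(z)}{\pi(1+|z|^2)^2}$ ($dA$ Lebesgue measure). It has reproducing kernel $K^\nu(x,y)=(1+x\overline y)^\nu$; the kernel of an operator $\Gamma$ on $\mathcal{H}_\nu$ is $\Gamma(x,y):=\Gamma(K^\nu(\cdot,y))(x)$. $C(\mathbb{CP}^1)$: continuous functions on $\mathbb{C}$ extending continuously to $\infty$, sup norm. $R_\nu(\Gamma)(z)=\Gamma(z,z)/(1+|z|^2)^\nu$; for a function $f$, $R_\nu^*(f)$ is the operator on $\mathcal{H}_\nu$ with $(R_\nu^*(f)h)(x)=\frac1{\nu+1}\int_{\mathbb{C}}f(z)h(z)(1+x\overline z)^\nu d\iota_\nu(z)$ (i.e. $\frac1{\nu+1}$ times the Toeplitz operator with symbol $f$); $R_\nu^*(f)^n$ is its $n$-th power. *)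

(* Defs.v *)
(* MathComp-Analysis + mathcomp-real-closed complex numbers R[i]. *)
From HB Require Import structures.
From mathcomp Require Import all_boot all_order all_algebra.
From mathcomp Require Import all_classical all_reals all_analysis.
From mathcomp Require Import complex.
Set Implicit Arguments. Unset Strict Implicit. Unset Printing Implicit Defensive.
Import Order.TTheory GRing.Theory Num.Theory.
Import numFieldNormedType.Exports.
Local Open Scope classical_set_scope.
Local Open Scope ring_scope.
Local Open Scope complex_scope.

Section Defs.
Variable R : realType.

(* identification of R x R with C *)
Definition cpx (p : R * R) : R[i] := p.1 +i* p.2.

(* |z|^2 and |z| as reals *)
Definition abs2 (z : R[i]) : R := complex.Re z ^+ 2 + complex.Im z ^+ 2.
Definition cnorm (z : R[i]) : R := Num.sqrt (abs2 z).

(* Lebesgue (area) measure dA on C = R x R *)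
Definition areaC := (@lebesgue_measure R \x @lebesgue_measure R)%E.

(* integral over C w.r.t. dA of a complex-valued function (real and imaginary parts) *)
Definition cintA (g : R[i] -> R[i]) : R[i] :=
  (Rintegral areaC setT (fun p => complex.Re (g (cpx p))))
  +i* (Rintegral areaC setT (fun p => complex.Im (g (cpx p)))).

(* density of d iota_nu w.r.t. dA *)
Definition iota_dens (nu : nat) (z : R[i]) : R :=
  (nu.+1)%:R / (1 + abs2 z) ^+ nu / (pi * (1 + abs2 z) ^+ 2).

(* integral w.r.t. d iota_nu *)
Definition iota_int (nu : nat) (g : R[i] -> R[i]) : R[i] :=
  cintA (fun z => g z * (iota_dens nu z)%:C).

(* reproducing kernel K^nu(., y) *)
Definition Kern (nu : nat) (y : R[i]) : R[i] -> R[i] :=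
  fun x => (1 + x * y^*) ^+ nu.

(* R_nu^*(f): (1/(nu+1)) times the Toeplitz operator with symbol f *)
Definition Rstar (nu : nat) (f : R[i] -> R[i]) (h : R[i] -> R[i]) : R[i] -> R[i] :=
  fun x => ((nu.+1)%:R)^-1 * iota_int nu (fun z => f z * h z * (1 + x * z^*) ^+ nu).

(* kernel of an operator Gamma *)
Definition op_kernel (nu : nat) (Gamma : (R[i] -> R[i]) -> (R[i] -> R[i]))
  (x y : R[i]) : R[i] := Gamma (Kern nu y) x.

(* R_nu (Berezin symbol) *)
Definition Rnu (nu : nat) (Gamma : (R[i] -> R[i]) -> (R[i] -> R[i])) (z : R[i]) : R[i] :=
  op_kernel nu Gamma z z / ((1 + abs2 z) ^+ nu)%:C.

(* n-th power of an operator *)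
Definition op_pow (n : nat) (Gamma : (R[i] -> R[i]) -> (R[i] -> R[i])) :=
  iter n Gamma.

(* sup norm *)
Definition supnorm (g : R[i] -> R[i]) : R := sup [set cnorm (g z) | z in setT].

(* C(CP^1): continuous on C, with a limit at infinity *)
Definition contCP1 (f : R[i] -> R[i]) : Prop :=
  (forall z0 : R[i], forall e : R, 0 < e -> exists d : R, 0 < d /\
      forall z, cnorm (z - z0) < d -> cnorm (f z - f z0) < e) /\
  (exists L : R[i], forall e : R, 0 < e -> exists M : R,
      forall z, M < cnorm z -> cnorm (f z - L) < e).

End Defs.

(* Main.v *)
Require Import Defs.
From HB Require Import structures.
From mathcomp Require Import all_boot all_order all_algebra.
From mathcomp Require Import all_classical all_reals all_analysis.
From mathcomp Require Import complex.
From mathcomp Require Import measurable_realfun ring lra zify.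
Import Order.TTheory GRing.Theory Num.Theory.
Import numFieldNormedType.Exports.
Local Open Scope classical_set_scope.
Local Open Scope ring_scope.
Set Implicit Arguments. Unset Strict Implicit. Unset Printing Implicit Defensive.

(** Write s(w) = sqrt(1 + |w|^2), let T be (nu+1) R_nu^*(f), the Toeplitz
    operator, and K_z = K^nu(., z).  Everything is measured in the weighted sup
    norm sup_w |h(w)| / s(w)^nu, in which |K_z| <= s(z)^nu by Lagrange's
    identity |1 + w conj(z)|^2 + |w - z|^2 = s(w)^2 s(z)^2.

    The reproducing property comes from Stokes' theorem on the plane: the
    function ((1 + x conj(w)) / (1 + |w|^2))^(nu+1) has antiholomorphic derivative
    (nu+1) (x - w) (1 + x conj(w))^nu / (1 + |w|^2)^(nu+2), so integrating a
    polynomial of degree at most nu that vanishes at x against K^nu(x, .) gives 0.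

    Since |1 + x conj(w)|^(2m) = |K^m(x, w)|^2, the reproducing property for the
    exponent m = nu/2 gives the Schur bound int |K^nu(x, w)| s(w)^nu diota_nu
    <= 2 s(x)^nu: T is bounded in the weighted norm uniformly in nu.  By the same
    bound T K_z - f(z) K_z is small: f(w) is close to f(z) when w is chordally
    close to z, and K_z(w) / (s(w) s(z))^nu decays geometrically elsewhere.
    Hence T^n K_z - f(z)^n K_z is small by induction, and evaluating it at z
    gives the theorem. *)

(** * Improper integrals over the real line from explicit primitives *)

Section RealLine.
Variable R : realType.
Local Notation mu := (@lebesgue_measure R).

(** The line is cut at 0. The fundamental theorem on a right half-line treats each half, the left
    one after the reflection x -> -x, which turns the primitive into -F(-x). *)
Lemma integral_derive_ge0 (F f : R -> R) (l m : R) :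
  (forall x, 0 <= f x) -> continuous f ->
  (forall x : R, is_derive x 1 F (f x)) ->
  F x @[x --> +oo] --> l -> F x @[x --> -oo] --> m ->
  (\int[mu]_x (f x)%:E = (l - m)%:E)%E.
Proof.
move=> f0 cf dF Fl Fm.
have cF : continuous F.
  move=> x; apply: differentiable_continuous; apply/derivable1_diffP.
  by apply: ex_derive; exact: dF.
have mf : measurable_fun [set: R] f by exact: continuous_measurable_fun.
have mP : measurable [set x : R | 0 <= x]%R by rewrite -set_itvcy.
rewrite -(setUv [set x : R | 0 <= x]%R) ge0_integral_setU//=; last 4 first.
- exact: measurableC.
- by apply/measurable_EFinP; rewrite setUv.
- by move=> x _; rewrite lee_fin.
- exact/disj_setPCl.
rewrite -set_itvcy// setCitvr.
rewrite integral_itv_bndo_bndc; last exact/measurable_EFinP/measurable_funTS.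
rewrite -{2}oppr0 ge0_integration_by_substitutionNy; last 2 first.
- exact: continuous_subspaceT.
- by move=> x _; exact: f0.
rewrite (@ge0_continuous_FTC2y _ f F _ l); last 6 first.
- by move=> x _; exact: f0.
- exact: continuous_subspaceT.
- exact: Fl.
- by move=> x _; apply: ex_derive; exact: dF.
- by apply: cvg_at_right_filter; exact: cF.
- by move=> x _; rewrite derive1E; apply: derive_val; exact: dF.
have dFN (x : R) : is_derive x 1 (fun x => - F (- x)) (f (- x)).
  have dN : is_derive x 1 (@GRing.opp R) (-1).
    by apply: is_deriveN.
  have := @is_derive1_comp _ F (@GRing.opp R) x _ _ (dF (- x)) dN.
  by move=> /is_deriveN h; apply: (is_derive_eq h); rewrite mulrN1 opprK.
rewrite (@ge0_continuous_FTC2y _ (f \o -%R) (fun x => - F (- x)) _ (- m)); last 6 first.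
- by move=> x _ /=.
- apply: continuous_subspaceT => x; apply: continuous_comp; last exact: cf.
  exact: opp_continuous.
- by apply: cvgN; move/cvgNy_compNP: Fm; apply.
- by move=> x _; apply: ex_derive; exact: dFN.
- apply: cvg_at_right_filter; apply: cvgN.
  by apply: (@continuous_comp _ _ _ -%R F); [exact: opp_continuous|exact: cF].
- by move=> x _; rewrite derive1E; apply: derive_val; exact: dFN.
by rewrite oppr0 -!EFinB -EFinD; congr EFin; ring.
Qed.

(** Since |F x| <= C / |x| away from 0, the boundary terms at both ends vanish. *)
Lemma cvg0_decay (F : R -> R) (C : R) :
  (forall x, `|x * F x| <= C) ->
  F x @[x --> +oo] --> (0 : R) /\ F x @[x --> -oo] --> (0 : R).
Proof.
move=> hF; have C0 : 0 <= C by apply: le_trans (hF 0); exact: normr_ge0.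
have key (e x : R) : 0 < e -> C / e < `|x| -> `|F x| < e.
  move=> e0 hx; have x0 : 0 < `|x| by apply: le_lt_trans hx; rewrite divr_ge0 // ltW.
  rewrite -(ltr_pM2l x0) -normrM; apply: le_lt_trans (hF x) _.
  by rewrite -ltr_pdivrMr.
split; apply/cvgrPdist_lt => e e0.
- near=> x; rewrite sub0r normrN; apply: key => //.
  by apply: lt_le_trans (ler_norm _); near: x; apply: nbhs_pinfty_gt; rewrite num_real.
- near=> x; rewrite sub0r normrN; apply: key => //.
  rewrite -normrN; apply: lt_le_trans (ler_norm _).
  by rewrite ltrNr; near: x; apply: nbhs_ninfty_lt; rewrite num_real.
Unshelve. all: by end_near. Qed.

Lemma cvgNy_atan : (@atan R) x @[x --> -oo] --> - (pi / 2).
Proof.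
apply/cvgNy_compNP; rewrite (_ : _ \o _ = (fun x => - atan x)).
  by apply: cvgN; exact: cvgy_atan.
by apply/funext => x /=; rewrite atanN.
Qed.

Lemma oneDsqr_gt0 (x : R) : 0 < 1 + x ^+ 2.
Proof. by have := sqr_ge0 x; lra. Qed.

Lemma continuous_oneDsqrV : continuous (fun x : R => (1 + x ^+ 2)^-1).
Proof.
move=> x; apply: cvgV; first by apply: lt0r_neq0; exact: oneDsqr_gt0.
by apply: cvgD; [exact: cvg_cst|exact: exprn_continuous].
Qed.

Lemma integral_oneDsqrV : (\int[mu]_x ((1 + x ^+ 2)^-1)%:E = pi%:E)%E.
Proof.
rewrite (@integral_derive_ge0 atan _ (pi / 2) (- (pi / 2))).
- by congr EFin; field.
- by move=> x; rewrite invr_ge0 ltW// oneDsqr_gt0.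
- exact: continuous_oneDsqrV.
- exact: cvgy_atan.
- exact: cvgNy_atan.
Qed.

(* The comparison function has the explicit primitive [atan], so adding
   [C] times it reduces the signed case to the nonnegative one. *)
Lemma integral_derive_decay (F f : R -> R) (C : R) :
  continuous f -> (forall x : R, is_derive x 1 F (f x)) ->
  (forall x, `|f x| <= C / (1 + x ^+ 2)) ->
  (forall x, `|x * F x| <= C) ->
  mu.-integrable setT (EFin \o f) /\ (\int[mu]_x (f x)%:E = 0)%E.
Proof.
move=> cf dF hf hF.
have [Fy FNy] := cvg0_decay hF.
have mf : measurable_fun [set: R] f by exact: continuous_measurable_fun.
have cD : continuous (fun x : R => C / (1 + x ^+ 2)).
  move=> x; apply: cvgM; [exact: cvg_cst|exact: continuous_oneDsqrV].
have iV : mu.-integrable setT (EFin \o (fun x : R => (1 + x ^+ 2)^-1)).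
  apply/integrableP; split.
    by apply/measurable_EFinP; apply: continuous_measurable_fun; exact: continuous_oneDsqrV.
  under eq_integral => x _.
    rewrite /= ger0_norm; last by rewrite invr_ge0 ltW// oneDsqr_gt0.
    over.
  by rewrite integral_oneDsqrV ltry.
have iD : mu.-integrable setT (EFin \o (fun x : R => C / (1 + x ^+ 2))).
  by have := integrableZl measurableT C iV.
have fint : mu.-integrable setT (EFin \o f).
  apply: (le_integrable measurableT _ _ iD).
    by apply/measurable_EFinP.
  move=> x _ /=; rewrite lee_fin; apply: le_trans (hf x) _; exact: ler_norm.
split => //.
have H : (\int[mu]_x (f x + C / (1 + x ^+ 2))%:E = (C * (pi / 2) - C * - (pi / 2))%:E)%E.
  apply: (@integral_derive_ge0 (fun x => F x + C * atan x)).
  - by move=> x; have := hf x; rewrite ler_norml => /andP[]; lra.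
  - by move=> x; apply: cvgD; [exact: cf|exact: cD].
  - rewrite -[X in _ --> X]add0r; apply: cvgD => //.
    by apply: cvgM; [exact: cvg_cst|exact: cvgy_atan].
  - rewrite -[X in _ --> X]add0r; apply: cvgD => //.
    by apply: cvgM; [exact: cvg_cst|exact: cvgNy_atan].
have HD : (\int[mu]_x (C / (1 + x ^+ 2))%:E = (C * pi)%:E)%E.
  have := @integralZl _ _ _ mu setT measurableT _ iV C.
  by rewrite /= integral_oneDsqrV -EFinM.
have : (\int[mu]_x (f x + C / (1 + x ^+ 2))%:E =
   \int[mu]_x (f x)%:E + \int[mu]_x (C / (1 + x ^+ 2))%:E)%E.
  by rewrite -integralD.
rewrite H HD => E.
have Ffin : (\int[mu]_x (f x)%:E)%E \is a fin_num by exact: (integrable_fin_num measurableT fint).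
rewrite -(fineK Ffin) -EFinD in E *; case: E => E; congr EFin.
by move: E; set u := fine _ => E; lra.
Qed.

End RealLine.

(** * Modulus and weight on the plane; measurability and continuity in real coordinates *)

Section ComplexPlane.
Variable R : realType.
Local Notation "x %:C" := (real_complex R x) (format "x %:C") : ring_scope.
Local Notation "x +i* y" := (Complex x y) : ring_scope.
Implicit Types (z w x : R[i]).

Lemma cnormE z : (cnorm z)%:C = `|z|.
Proof. by rewrite normc_def. Qed.

Lemma cnorm_ge0 z : 0 <= cnorm z.
Proof. exact: sqrtr_ge0. Qed.

Lemma cnormM z w : cnorm (z * w) = cnorm z * cnorm w.
Proof. by apply: (@complexI R); rewrite rmorphM /= !cnormE normrM. Qed.

Lemma cnormX z n : cnorm (z ^+ n) = cnorm z ^+ n.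
Proof. by apply: (@complexI R); rewrite rmorphXn /= !cnormE normrX. Qed.

Lemma cnormN z : cnorm (- z) = cnorm z.
Proof. by apply: (@complexI R); rewrite !cnormE normrN. Qed.

Lemma cnormD z w : cnorm (z + w) <= cnorm z + cnorm w.
Proof. by rewrite -lecR rmorphD /= !cnormE ler_normD. Qed.

Lemma cnormB z w : cnorm (z - w) <= cnorm z + cnorm w.
Proof. by rewrite -(cnormN w) cnormD. Qed.

Lemma cnorm_real (r : R) : cnorm r%:C = `|r|.
Proof. by rewrite /cnorm /abs2 /= expr0n addr0 sqrtr_sqr. Qed.

Lemma cnorm0 : cnorm (0 : R[i]) = 0.
Proof. by have := cnorm_real 0; rewrite normr0. Qed.

Lemma cnormJ z : cnorm z^* = cnorm z.
Proof. by case: z => a b; rewrite /cnorm /abs2 /= sqrrN. Qed.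

Lemma conj_real (r : R) : (r%:C)^* = r%:C.
Proof. exact: conjc_real. Qed.

Lemma cnorm_sqr z : cnorm z ^+ 2 = abs2 z.
Proof. by rewrite sqr_sqrtr // addr_ge0 ?sqr_ge0. Qed.

Lemma abs2_ge0 z : 0 <= abs2 z.
Proof. by rewrite -cnorm_sqr sqr_ge0. Qed.

Lemma abs2E z : (abs2 z)%:C = z * z^*.
Proof.
by case: z => a b; rewrite /abs2; simpc => /=; congr (_ +i* _); ring.
Qed.

Lemma Re_le_cnorm z : `|complex.Re z| <= cnorm z.
Proof.
by rewrite -sqrtr_sqr /cnorm ler_wsqrtr // /abs2 lerDl sqr_ge0.
Qed.

Lemma Im_le_cnorm z : `|complex.Im z| <= cnorm z.
Proof.
by rewrite -sqrtr_sqr /cnorm ler_wsqrtr // /abs2 lerDr sqr_ge0.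
Qed.

Lemma cnorm_le_ReIm z : cnorm z <= `|complex.Re z| + `|complex.Im z|.
Proof.
case: z => a b /=; have -> : a +i* b = a%:C + 'i%C * b%:C by simpc.
apply: le_trans (cnormD _ _) _; rewrite cnormM !cnorm_real.
suff -> : cnorm ('i%C : R[i]) = 1 by rewrite mul1r.
by rewrite /cnorm /abs2 /= expr0n add0r expr1n sqrtr1.
Qed.

(** The Japanese bracket, written s in the overview; [jap z ^+ n] is the square root of K^n(z, z),
    the norm of the kernel function at z. *)
Definition jap z : R := Num.sqrt (1 + abs2 z).

Lemma jap_sqr z : jap z ^+ 2 = 1 + abs2 z.
Proof. by rewrite sqr_sqrtr // addr_ge0 // abs2_ge0. Qed.

Lemma jap_ge1 z : 1 <= jap z.
Proof. by rewrite -[X in X <= _]sqrtr1 ler_wsqrtr // lerDl abs2_ge0. Qed.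

Lemma jap_gt0 z : 0 < jap z.
Proof. exact: lt_le_trans (jap_ge1 z). Qed.

Lemma jap_ge0 z : 0 <= jap z.
Proof. exact/ltW/jap_gt0. Qed.

Lemma cnorm_le_jap z : cnorm z <= jap z.
Proof. by rewrite ler_wsqrtr // lerDr. Qed.

Lemma oneDabs2_gt0 z : 0 < 1 + abs2 z.
Proof. by have := abs2_ge0 z; lra. Qed.

(* Lagrange's identity; [cnorm (w - z) / (jap w * jap z)] is the chordal distance. *)
Lemma kernel_chordal z w :
  cnorm (1 + w * z^*) ^+ 2 + cnorm (w - z) ^+ 2 = (jap w * jap z) ^+ 2.
Proof.
rewrite exprMn !jap_sqr !cnorm_sqr; case: z => a b; case: w => c d.
by rewrite /abs2; simpc => /=; ring.
Qed.

Lemma kernel_le_jap z w : cnorm (1 + w * z^*) <= jap w * jap z.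
Proof.
have j0 : 0 <= jap w * jap z by rewrite mulr_ge0 // ltW // jap_gt0.
rewrite -(@ler_pXn2r _ 2) ?nnegrE ?cnorm_ge0 //.
by rewrite -(kernel_chordal z w) lerDl sqr_ge0.
Qed.

(** An open set of the plane is a countable union of squares with rational centre and radius, and
    squares belong to the product sigma-algebra. *)
Lemma open_prod_measurable (O : set (R * R)) : open O -> measurable O.
Proof.
move=> oO.
pose B (k : rat * rat * rat) : set (R * R) :=
  ball (ratr k.1.1 : R) (ratr k.2 : R) `*` ball (ratr k.1.2 : R) (ratr k.2 : R).
(* Squares not contained in O are replaced by the empty set, so that the union runs over all
   rational triples. *)
have -> : O = \bigcup_k (if `[< B k `<=` O >] then B k else set0).
  apply/seteqP; split => [p Op|p [k _]]; last first.
    by case: asboolP => // h /h.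
  move: (oO); rewrite openE => /(_ _ Op) /nbhs_ballP[e /= e0 He].
  have e40 : 0 < e / 4 by lra.
  (* With r < e / 2 and a rational centre within r of p, the square of radius r contains p and stays
     within 2 r < e of it. *)
  have [r] := @rat_in_itvoo R 0 (e / 2) ltac:(lra).
  rewrite in_itv/= => /andP[r0 re].
  have [q1] := @rat_in_itvoo R (p.1 - ratr r) (p.1 + ratr r) ltac:(lra).
  rewrite in_itv/= => /andP[q11 q12].
  have [q2] := @rat_in_itvoo R (p.2 - ratr r) (p.2 + ratr r) ltac:(lra).
  rewrite in_itv/= => /andP[q21 q22].
  exists (q1, q2, r) => //; case: asboolP => [_|[]].
    by split => /=; rewrite /ball /= ltr_norml; lra.
  move=> q [] /=; rewrite /ball /= !ltr_norml => h1 h2; apply: He.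
  by split => /=; rewrite /ball /= ltr_norml; lra.
apply: countable_bigcupT_measurable => // k.
case: asboolP => // _; apply: measurableX; exact: measurable_ball.
Qed.

Lemma continuous_prod_measurable_fun (g : R * R -> R) :
  continuous g -> measurable_fun setT g.
Proof.
move=> /continuousP cg; apply: (measurability _ (RGenOpens.measurableE R)).
move=> _ [_ [a [b ->] <-]]; rewrite setTI.
by apply: open_prod_measurable; apply: cg; exact: interval_open.
Qed.

(** Continuity is split into real and imaginary parts over R x R, the form in which [cintA]
    integrates. *)
Definition ccont (g : R[i] -> R[i]) :=
  continuous (fun p : R * R => complex.Re (g (cpx p))) /\
  continuous (fun p : R * R => complex.Im (g (cpx p))).

Definition rcont (g : R[i] -> R) := continuous (fun p : R * R => g (cpx p)).

Lemma ccont_cst (c : R[i]) : ccont (fun=> c).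
Proof. by split => p; exact: cvg_cst. Qed.

Lemma ccont_id : ccont id.
Proof. by split => p; [exact: cvg_fst|exact: cvg_snd]. Qed.

Lemma ccont_conj (g : R[i] -> R[i]) : ccont g -> ccont (fun w => (g w)^*).
Proof.
move=> [c1 c2]; split => p.
  rewrite (_ : (fun _ => _) = (fun p : R * R => complex.Re (g (cpx p)))); first exact: c1.
  by apply/funext => q; case: (g _).
rewrite (_ : (fun _ => _) = (fun p : R * R => - complex.Im (g (cpx p)))).
  by apply: cvgN; exact: c2.
by apply/funext => q; case: (g _).
Qed.

Lemma ccontD (g h : R[i] -> R[i]) : ccont g -> ccont h -> ccont (fun w => g w + h w).
Proof.
move=> [g1 g2] [h1 h2]; split => p.
  rewrite (_ : (fun _ => _) = (fun p : R * R => complex.Re (g (cpx p)) + complex.Re (h (cpx p)))).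
    by apply: cvgD; [exact: g1|exact: h1].
  by apply/funext => q; case: (g _); case: (h _).
rewrite (_ : (fun _ => _) = (fun p : R * R => complex.Im (g (cpx p)) + complex.Im (h (cpx p)))).
  by apply: cvgD; [exact: g2|exact: h2].
by apply/funext => q; case: (g _); case: (h _).
Qed.

Lemma ReM z w : complex.Re (z * w) =
  complex.Re z * complex.Re w - complex.Im z * complex.Im w.
Proof. by case: z; case: w. Qed.

Lemma ImM z w : complex.Im (z * w) =
  complex.Re z * complex.Im w + complex.Im z * complex.Re w.
Proof. by case: z; case: w. Qed.

Lemma ccontM (g h : R[i] -> R[i]) : ccont g -> ccont h -> ccont (fun w => g w * h w).
Proof.
move=> [g1 g2] [h1 h2]; split => p.
  rewrite (_ : (fun _ => _) = (fun p : R * R => complex.Re (g (cpx p)) * complex.Re (h (cpx p))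
      - complex.Im (g (cpx p)) * complex.Im (h (cpx p)))).
    by apply: cvgB; apply: cvgM; [exact: g1|exact: h1|exact: g2|exact: h2].
  by apply/funext => q; rewrite ReM.
rewrite (_ : (fun _ => _) = (fun p : R * R => complex.Re (g (cpx p)) * complex.Im (h (cpx p))
    + complex.Im (g (cpx p)) * complex.Re (h (cpx p)))).
  by apply: cvgD; apply: cvgM; [exact: g1|exact: h2|exact: g2|exact: h1].
by apply/funext => q; rewrite ImM.
Qed.

Lemma ccont_real (r : R[i] -> R) : rcont r -> ccont (fun w => (r w)%:C).
Proof. by move=> cr; split => p; [exact: cr|exact: cvg_cst]. Qed.

Lemma rcont_abs2 (g : R[i] -> R[i]) : ccont g -> rcont (fun w => abs2 (g w)).
Proof.
by move=> [g1 g2] p; apply: cvgD; apply: cvgM; [exact: g1|exact: g1|exact: g2|exact: g2].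
Qed.

Lemma rcont_cnorm (g : R[i] -> R[i]) : ccont g -> rcont (fun w => cnorm (g w)).
Proof.
move=> /rcont_abs2 cg p.
apply: (@continuous_comp _ _ _ (fun p : R * R => abs2 (g (cpx p))) Num.sqrt).
  exact: cg.
exact: sqrt_continuous.
Qed.

Lemma rcont_oneDabs2 : rcont (fun w => 1 + abs2 w).
Proof. by move=> p; apply: cvgD; [exact: cvg_cst|exact: (rcont_abs2 ccont_id)]. Qed.

Lemma rcont_oneDabs2V : rcont (fun w => (1 + abs2 w)^-1).
Proof.
by move=> p; apply: cvgV; [exact: lt0r_neq0 (oneDabs2_gt0 _)|exact: rcont_oneDabs2].
Qed.

Lemma rcontM (g h : R[i] -> R) : rcont g -> rcont h -> rcont (fun w => g w * h w).
Proof. by move=> cg ch p; apply: cvgM; [exact: cg|exact: ch]. Qed.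

Lemma rcontX (g : R[i] -> R) n : rcont g -> rcont (fun w => g w ^+ n).
Proof.
move=> cg; elim: n => [|n IH]; first by move=> p; exact: cvg_cst.
move=> p; rewrite (_ : (fun _ => _) = (fun p : R * R => g (cpx p) * g (cpx p) ^+ n)).
  by apply: cvgM; [exact: cg|exact: IH].
by apply/funext => q; rewrite exprS.
Qed.

End ComplexPlane.

(** * Closed forms of the one-dimensional integrals that arise in the iterated integrals *)

Section LineIntegrals.
Variable R : realType.
Local Notation mu := (@lebesgue_measure R).

Lemma atan_divr_cvg (c : R) : 0 < c ->
  atan (x / c) @[x --> +oo] --> pi / 2 /\ atan (x / c) @[x --> -oo] --> - (pi / 2).
Proof.
move=> c0; split.
  apply: (@cvg_comp _ _ _ (fun x : R => x / c) (@atan R) _ +oo); last exact: cvgy_atan.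
  apply/cvgryPge => A; apply: filterS (nbhs_pinfty_ge (num_real (A * c))) => x.
  by rewrite ler_pdivlMr.
apply: (@cvg_comp _ _ _ (fun x : R => x / c) (@atan R) _ -oo); last exact: cvgNy_atan.
apply/cvgrNyPle => A; apply: filterS (nbhs_ninfty_le (num_real (A * c))) => x.
by rewrite ler_pdivrMr.
Qed.

Lemma is_derive_atan_divr (c x : R) : 0 < c ->
  is_derive x 1 (fun x : R => atan (x / c)) (c / (c ^+ 2 + x ^+ 2)).
Proof.
move=> c0.
have d1 : is_derive x 1 (fun x : R => x / c) c^-1.
  have h := @is_deriveM _ _ id (cst c^-1) x 1 _ _ (is_derive_id _ _) (is_derive_cst _ _ _).
  by apply: (is_derive_eq h); rewrite /= scaler0 add0r /GRing.scale /= mulr1.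
have h := @is_derive1_comp _ (@atan R) (fun x => x / c) x _ _ (is_derive1_atan _) d1.
apply: (is_derive_eq h).
have : 0 < c ^+ 2 + x ^+ 2 by rewrite ltr_pwDl ?exprn_gt0 ?sqr_ge0.
move=> /lt0r_neq0 e1; have e2 := lt0r_neq0 c0.
by field; rewrite e1 e2.
Qed.

Lemma continuous_sqDV (c : R) n : 0 < c -> continuous (fun x : R => ((c ^+ 2 + x ^+ 2) ^+ n)^-1).
Proof.
move=> c0 x; apply: cvgV.
  by apply: expf_neq0; apply: lt0r_neq0; rewrite ltr_pwDl ?exprn_gt0 ?sqr_ge0.
apply: (@continuous_comp _ _ _ (fun x : R => c ^+ 2 + x ^+ 2) (fun y => y ^+ n)).
  by apply: cvgD; [exact: cvg_cst|exact: exprn_continuous].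
exact: exprn_continuous.
Qed.

(** The primitive is atan (x / c) / c^2. This is the inner integral of the majorant in
    [rint_japV3]. *)
Lemma integral_sqDV (c : R) : 0 < c ->
  (\int[mu]_x ((c * (c ^+ 2 + x ^+ 2))^-1)%:E = (pi / c ^+ 2)%:E)%E.
Proof.
move=> c0; have [cy cNy] := atan_divr_cvg c0.
have dF (x : R) : is_derive x 1 (fun x : R => (c ^+ 2)^-1 * atan (x / c)) ((c * (c ^+ 2 + x ^+ 2))^-1).
  have h := @is_deriveZ _ _ _ (fun x : R => atan (x / c)) ((c ^+ 2)^-1) x 1 _ (is_derive_atan_divr x c0).
  apply: (is_derive_eq h); rewrite /GRing.scale /=.
  have : 0 < c ^+ 2 + x ^+ 2 by rewrite ltr_pwDl ?exprn_gt0 ?sqr_ge0.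
  move=> /lt0r_neq0 e1; have e2 := lt0r_neq0 c0.
  by field; rewrite e1 e2.
have cc : continuous (fun x : R => (c * (c ^+ 2 + x ^+ 2))^-1).
  rewrite (_ : (fun _ => _) = (fun x : R => c^-1 * ((c ^+ 2 + x ^+ 2) ^+ 1)^-1)).
    by move=> x; apply: cvgM; [exact: cvg_cst|exact: continuous_sqDV].
  by apply/funext => x; rewrite invfM.
rewrite (@integral_derive_ge0 _ _ _ ((c ^+ 2)^-1 * (pi / 2)) ((c ^+ 2)^-1 * - (pi / 2)) _ cc dF).
- by congr EFin; field; exact: lt0r_neq0.
- by move=> x; rewrite invr_ge0 mulr_ge0 ?addr_ge0 ?sqr_ge0 // ltW.
- by apply: cvgM => //; exact: cvg_cst.
- by apply: cvgM => //; exact: cvg_cst.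
Qed.

(** The primitive is atan (x / c) / (2 c^3) + x / (2 c^2 (c^2 + x^2)). With c = sqrt (1 + a^2) this
    is the integral of (1 + |w|^2)^(-2) along the line Re w = a. *)
Lemma integral_sqDV2 (c : R) : 0 < c ->
  (\int[mu]_x (((c ^+ 2 + x ^+ 2) ^+ 2)^-1)%:E = (pi / 2 * (c ^+ 3)^-1)%:E)%E.
Proof.
move=> c0; have [cy cNy] := atan_divr_cvg c0.
have e1 (x : R) : 0 < c ^+ 2 + x ^+ 2 by rewrite ltr_pwDl ?exprn_gt0 ?sqr_ge0.
have e2 := lt0r_neq0 c0.
pose k := (2 * c ^+ 3)^-1; pose l := (2 * c ^+ 2)^-1.
have dF (x : R) : is_derive x 1 (fun x : R => k * atan (x / c) + l * (x * (c ^+ 2 + x ^+ 2)^-1))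
    (((c ^+ 2 + x ^+ 2) ^+ 2)^-1).
  have h1 := @is_deriveZ _ _ _ (fun x : R => atan (x / c)) k x 1 _ (is_derive_atan_divr x c0).
  have q : is_derive x 1 (fun x : R => c ^+ 2 + x ^+ 2) (2 * x).
    have h := @is_deriveM _ _ (@id R) id x 1 _ _ (is_derive_id _ _) (is_derive_id _ _).
    have h' := @is_deriveD _ _ _ (cst (c ^+ 2)) _ x 1 _ _ (is_derive_cst _ _ _) h.
    by apply: (is_derive_eq h'); rewrite add0r /GRing.scale /=; ring.
  have qv := @is_deriveV _ (fun x : R => c ^+ 2 + x ^+ 2) x _ 1 (lt0r_neq0 (e1 x)) q.
  have qm := @is_deriveM _ _ (@id R) _ x 1 _ _ (is_derive_id _ _) qv.
  have h2 := @is_deriveZ _ _ _ _ l x 1 _ qm.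
  apply: (is_derive_eq (is_deriveD h1 h2)).
  rewrite /GRing.scale /= /k /l.
  have := lt0r_neq0 (e1 x); move=> e3.
  by field; rewrite e3 e2.
have [d1 d2] : ((fun x : R => l * (x * (c ^+ 2 + x ^+ 2)^-1)) x @[x --> +oo] --> (0 : R)) /\
   ((fun x : R => l * (x * (c ^+ 2 + x ^+ 2)^-1)) x @[x --> -oo] --> (0 : R)).
  apply: (@cvg0_decay _ _ l) => x.
  have l0 : 0 < l by rewrite invr_gt0 mulr_gt0 // exprn_gt0.
  have -> : x * (l * (x * (c ^+ 2 + x ^+ 2)^-1)) = l * (x ^+ 2 / (c ^+ 2 + x ^+ 2)) by ring.
  rewrite ger0_norm; last by rewrite mulr_ge0 ?divr_ge0 ?sqr_ge0 // ltW.
  by apply: ler_piMr; [exact: ltW|rewrite ler_pdivrMr // mul1r lerDr sqr_ge0].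
rewrite (@integral_derive_ge0 _ _ _ (k * (pi / 2) + 0) (k * - (pi / 2) + 0) _ _ dF).
- by congr EFin; rewrite /k; field.
- by move=> x; rewrite invr_ge0 exprn_ge0 // ltW.
- exact: continuous_sqDV.
- by apply: cvgD => //; apply: cvgM => //; exact: cvg_cst.
- by apply: cvgD => //; apply: cvgM => //; exact: cvg_cst.
Qed.

Lemma continuous_japV3 : continuous (fun x : R => (Num.sqrt (1 + x ^+ 2) ^+ 3)^-1).
Proof.
move=> x; apply: cvgV.
  by apply: expf_neq0; rewrite sqrtr_eq0 -ltNge oneDsqr_gt0.
apply: (@continuous_comp _ _ _ (fun x : R => Num.sqrt (1 + x ^+ 2)) (fun y => y ^+ 3)).
  apply: (@continuous_comp _ _ _ (fun x : R => 1 + x ^+ 2) Num.sqrt).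
    by apply: cvgD; [exact: cvg_cst|exact: exprn_continuous].
  exact: sqrt_continuous.
exact: exprn_continuous.
Qed.

(** The primitive is sin (atan x) = x / sqrt (1 + x^2). This is the outer integral in [mass0]. *)
Lemma integral_japV3 : (\int[mu]_x ((Num.sqrt (1 + x ^+ 2) ^+ 3)^-1)%:E = 2%:E)%E.
Proof.
have dF (x : R) : is_derive x 1 (fun x : R => sin (atan x)) ((Num.sqrt (1 + x ^+ 2) ^+ 3)^-1).
  have h := @is_derive1_comp _ (@sin R) (@atan R) x _ _ (is_derive_sin _) (is_derive1_atan x).
  apply: (is_derive_eq h); rewrite cos_atan.
  have e : (1 + x ^+ 2) = Num.sqrt (1 + x ^+ 2) ^+ 2.
    by rewrite sqr_sqrtr // ltW // oneDsqr_gt0.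
  by rewrite [X in _ * X^-1]e -invfM -exprS.
rewrite (@integral_derive_ge0 _ _ _ 1 (-1) _ continuous_japV3 dF).
- by congr EFin; ring.
- by move=> x; rewrite invr_ge0 exprn_ge0 // sqrtr_ge0.
- rewrite -[X in _ --> X](sin_pihalf R).
  apply: (@cvg_comp _ _ _ (@atan R) (@sin R) _ (nbhs (pi / 2 : R))); first exact: cvgy_atan.
  exact: continuous_sin.
- have -> : -1 = sin (- (pi / 2)) :> R by rewrite sinN sin_pihalf.
  apply: (@cvg_comp _ _ _ (@atan R) (@sin R) _ (nbhs (- (pi / 2) : R))); first exact: cvgNy_atan.
  exact: continuous_sin.
Qed.

End LineIntegrals.

(** * Integration over the plane, and integrals of partial derivatives *)

Section PlaneIntegral.
Variable R : realType.
Local Notation "x %:C" := (real_complex R x) (format "x %:C") : ring_scope.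
Local Notation "x +i* y" := (Complex x y) : ring_scope.
Local Notation mu2 := (@lebesgue_measure R \x @lebesgue_measure R)%E.
Implicit Types (z w : R[i]) (g h : R[i] -> R[i]) (r : R[i] -> R).

Definition rint r := mu2.-integrable setT (EFin \o (fun p => r (cpx p))).
Definition cint g := rint (fun w => complex.Re (g w)) /\ rint (fun w => complex.Im (g w)).

Lemma jap_cpx (a b : R) : jap (a +i* b) = Num.sqrt (Num.sqrt (1 + a ^+ 2) ^+ 2 + b ^+ 2).
Proof. by rewrite /jap /abs2 /= sqr_sqrtr ?addrA // ltW // oneDsqr_gt0. Qed.

Lemma rcont_jap : rcont (@jap R).
Proof.
move=> p; apply: (@continuous_comp _ _ _ (fun p : R * R => 1 + abs2 (cpx p)) Num.sqrt).
  exact: rcont_oneDabs2.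
exact: sqrt_continuous.
Qed.

Lemma rcontV r : (forall w, r w != 0) -> rcont r -> rcont (fun w => (r w)^-1).
Proof. by move=> r0 cr p; apply: cvgV; [exact: r0|exact: cr]. Qed.

Lemma rcont_japVn n : rcont (fun w : R[i] => (jap w ^+ n)^-1).
Proof.
apply: rcontV; last exact: rcontX rcont_jap.
by move=> w; apply: expf_neq0; apply: lt0r_neq0; exact: jap_gt0.
Qed.

(** At w = a + i b, with c = sqrt (1 + a^2), one has jap w >= c and jap w ^ 2 = c^2 + b^2, so 1 / (c
    (c^2 + b^2)) is a majorant. Its integral in b is pi / (1 + a^2), which is integrable in a. The
    exponent 3 is the least integer that is integrable on the plane, and serves as the standard
    decay below. *)
Lemma rint_japV3 : rint (fun w => (jap w ^+ 3)^-1).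
Proof.
pose c (a : R) := Num.sqrt (1 + a ^+ 2).
have c0 a : 0 < c a by rewrite sqrtr_gt0 oneDsqr_gt0.
pose D (p : R * R) : R := (c p.1 * (c p.1 ^+ 2 + p.2 ^+ 2))^-1.
have D0 p : 0 <= D p by rewrite invr_ge0 mulr_ge0 ?addr_ge0 ?sqr_ge0 // ltW.
have cc : continuous (fun p : R * R => c p.1).
  move=> p; apply: (@continuous_comp _ _ _ (fun p : R * R => 1 + p.1 ^+ 2) Num.sqrt).
    by apply: cvgD; [exact: cvg_cst|apply: cvgM; exact: cvg_fst].
  exact: sqrt_continuous.
have cD : continuous D.
  move=> p; apply: cvgV.
    by rewrite mulf_neq0 // lt0r_neq0 // ltr_pwDl ?exprn_gt0 ?sqr_ge0.
  apply: cvgM; first exact: cc.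
  apply: cvgD; first by apply: cvgM; exact: cc.
  by apply: cvgM; exact: cvg_snd.
have iD : mu2.-integrable setT (EFin \o D).
  apply/integrable12ltyP.
    by apply/measurable_EFinP; exact: continuous_prod_measurable_fun.
  under eq_integral => a _.
    under eq_integral => b _ do rewrite /= ger0_norm //.
    rewrite /D /= integral_sqDV // sqr_sqrtr; last by rewrite ltW // oneDsqr_gt0.
    rewrite EFinM.
    over.
  rewrite ge0_integralZl//; last 3 first.
  - apply/measurable_EFinP; apply: continuous_measurable_fun.
    exact: continuous_oneDsqrV.
  - by move=> x _; rewrite lee_fin invr_ge0 ltW // oneDsqr_gt0.
  - by rewrite lee_fin pi_ge0.
  by rewrite integral_oneDsqrV -EFinM ltry.
apply: (le_integrable measurableT _ _ iD).
  by apply/measurable_EFinP; apply: continuous_prod_measurable_fun; exact: rcont_japVn.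
move=> [a b] _; rewrite /= lee_fin [X in _ <= X]ger0_norm // ger0_norm; last first.
  by rewrite invr_ge0 exprn_ge0 // ltW // jap_gt0.
rewrite /D /= lef_pV2 ?posrE ?exprn_gt0 ?jap_gt0 //; last first.
  by rewrite mulr_gt0 // ltr_pwDl ?exprn_gt0 ?sqr_ge0.
have e : 0 <= c a ^+ 2 + b ^+ 2 by rewrite addr_ge0 ?sqr_ge0.
rewrite /cpx /= jap_cpx -/(c a) [X in _ <= X]exprS (sqr_sqrtr e) ler_wpM2r //.
rewrite -{1}(ger0_norm (ltW (c0 a))) -sqrtr_sqr ler_wsqrtr //.
by rewrite lerDl sqr_ge0.
Qed.

Lemma rint_dom r s : rcont r -> rint s -> (forall w, `|r w| <= s w) -> rint r.
Proof.
move=> cr is_ rs; apply: (le_integrable measurableT _ _ is_).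
  by apply/measurable_EFinP; exact: continuous_prod_measurable_fun.
by move=> p _ /=; rewrite lee_fin; apply: le_trans (rs _) _; exact: ler_norm.
Qed.

Lemma rintZ r (k : R) : rint r -> rint (fun w => k * r w).
Proof. by move=> ir; have := integrableZl measurableT k ir. Qed.

Lemma rintD r s : rint r -> rint s -> rint (fun w => r w + s w).
Proof. by move=> ir is_; have := integrableD measurableT ir is_. Qed.

Lemma cint_dom g s : ccont g -> rint s -> (forall w, cnorm (g w) <= s w) -> cint g.
Proof.
move=> [c1 c2] is_ gs; split; apply: (rint_dom _ is_) => // w;
  apply: le_trans (gs w); [exact: Re_le_cnorm|exact: Im_le_cnorm].
Qed.

Lemma cint_jap g C : ccont g -> (forall w, cnorm (g w) <= C / jap w ^+ 3) -> cint g.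
Proof. by move=> cg; apply: cint_dom => //; apply: rintZ; exact: rint_japV3. Qed.

Definition rI r := Rintegral mu2 setT (fun p => r (cpx p)).

Lemma cintAE g : cintA g = rI (fun w => complex.Re (g w)) +i* rI (fun w => complex.Im (g w)).
Proof. by []. Qed.

Lemma rID r s : rint r -> rint s -> rI (fun w => r w + s w) = rI r + rI s.
Proof. by move=> ir is_; rewrite /rI RintegralD. Qed.

Lemma rIZ r k : rint r -> rI (fun w => k * r w) = k * rI r.
Proof. by move=> ir; rewrite /rI RintegralZl. Qed.

Lemma rI_le r s : rint r -> rint s -> (forall w, r w <= s w) -> rI r <= rI s.
Proof. by move=> ir is_ rs; apply: le_Rintegral => // p _; exact: rs. Qed.

Lemma rI_norm_le r s : rint r -> rint s -> (forall w, `|r w| <= s w) -> `|rI r| <= rI s.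
Proof.
move=> ir is_ rs; rewrite ler_norml -mulN1r -rIZ //; apply/andP; split; apply: rI_le => //.
- exact: rintZ.
- by move=> w; have := rs w; rewrite ler_norml => /andP[]; lra.
- by move=> w; have := rs w; rewrite ler_norml => /andP[].
Qed.

(** The factor 2 comes from bounding the real and imaginary parts separately; what matters later is
    that it is independent of nu. *)
Lemma cnorm_cintA_le g s : cint g -> rint s -> (forall w, cnorm (g w) <= s w) ->
  cnorm (cintA g) <= 2 * rI s.
Proof.
move=> [g1 g2] is_ gs; apply: le_trans (cnorm_le_ReIm _) _; rewrite cintAE mulr2n mulrDl mul1r /=.
by apply: lerD; apply: rI_norm_le => // w; apply: le_trans (gs w);
  [exact: Re_le_cnorm|exact: Im_le_cnorm].
Qed.

Lemma eq_cintA g h : g =1 h -> cintA g = cintA h.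
Proof. by move=> /funext ->. Qed.

Lemma eq_cint g h : g =1 h -> cint g -> cint h.
Proof. by move=> /funext ->. Qed.

Lemma ReD z w : complex.Re (z + w) = complex.Re z + complex.Re w.
Proof. by case: z; case: w. Qed.

Lemma ImD z w : complex.Im (z + w) = complex.Im z + complex.Im w.
Proof. by case: z; case: w. Qed.

Lemma cintD g h : cint g -> cint h -> cint (fun w => g w + h w).
Proof.
move=> [g1 g2] [h1 h2]; split.
  by under [X in rint X]eq_fun do rewrite ReD; exact: rintD.
by under [X in rint X]eq_fun do rewrite ImD; exact: rintD.
Qed.

Lemma cintAD g h : cint g -> cint h -> cintA (fun w => g w + h w) = cintA g + cintA h.
Proof.
move=> [g1 g2] [h1 h2]; rewrite !cintAE; simpc.
under [X in rI X +i* _]eq_fun do rewrite ReD.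
under [X in _ +i* rI X]eq_fun do rewrite ImD.
by rewrite !rID.
Qed.

Lemma cintZ g (c : R[i]) : cint g -> cint (fun w => c * g w).
Proof.
move=> [g1 g2]; split.
  under [X in rint X]eq_fun do rewrite ReM -mulNr.
  by apply: rintD; exact: rintZ.
under [X in rint X]eq_fun do rewrite ImM.
by apply: rintD; exact: rintZ.
Qed.

Lemma cintAZ g (c : R[i]) : cint g -> cintA (fun w => c * g w) = c * cintA g.
Proof.
case: c => a b [g1 g2]; rewrite !cintAE; simpc.
under [X in rI X +i* _]eq_fun do rewrite ReM -mulNr.
under [X in _ +i* rI X]eq_fun do rewrite ImM.
by rewrite !rID ?rIZ //; do ?exact: rintZ; rewrite mulNr.
Qed.

Lemma cint0 : cint (fun=> 0).
Proof. by split; exact: integrable0. Qed.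

Lemma cintA0 : cintA (fun=> 0 : R[i]) = 0.
Proof.
by have := cintAZ 0 cint0; under eq_cintA do rewrite mul0r; rewrite mul0r.
Qed.

Lemma cint_sum n (G : 'I_n -> R[i] -> R[i]) : (forall i, cint (G i)) ->
  cint (fun w => \sum_(i < n) G i w).
Proof.
elim: n G => [|n IH] G iG.
  by apply: eq_cint cint0 => w; rewrite big_ord0.
have := cintD (iG ord0) (IH (fun i => G (lift ord0 i)) (fun i => iG _)).
by apply: eq_cint => w; rewrite big_ord_recl.
Qed.

Lemma cintA_sum n (G : 'I_n -> R[i] -> R[i]) : (forall i, cint (G i)) ->
  cintA (fun w => \sum_(i < n) G i w) = \sum_(i < n) cintA (G i).
Proof.
elim: n G => [|n IH] G iG.
  by rewrite big_ord0 -[RHS]cintA0; apply: eq_cintA => w; rewrite big_ord0.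
rewrite big_ord_recl -IH // -cintAD //; last by apply: cint_sum.
by apply: eq_cintA => w; rewrite big_ord_recl.
Qed.

Lemma cintA_conj g : cint g -> cintA (fun w => (g w)^*) = (cintA g)^*.
Proof.
move=> [g1 g2]; rewrite !cintAE /=.
have -> : (fun w => complex.Re (g w)^*) = (fun w => complex.Re (g w)).
  by apply/funext => w; case: (g w).
have -> : (fun w => complex.Im (g w)^*) = (fun w => (-1) * complex.Im (g w)).
  by apply/funext => w; case: (g w) => a b /=; rewrite mulN1r.
by rewrite rIZ // mulN1r.
Qed.

Lemma cintA_real r : cintA (fun w => (r w)%:C) = (rI r)%:C.
Proof. by rewrite cintAE /= /rI Rintegral_cst // mul0r. Qed.

Lemma jap_ge_Re w : 1 + complex.Re w ^+ 2 <= jap w ^+ 2.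
Proof. by rewrite jap_sqr /abs2 addrA lerDl sqr_ge0. Qed.

Lemma jap_ge_Im w : 1 + complex.Im w ^+ 2 <= jap w ^+ 2.
Proof. by rewrite jap_sqr /abs2 addrCA lerDr sqr_ge0. Qed.

(** Turns decay in the plane into the two hypotheses of [integral_derive_decay] along a horizontal
    or vertical line with running coordinate t. The second half uses |t| <= 1 + t^2. *)
Lemma decay_line (t C u : R) w : 1 + t ^+ 2 <= jap w ^+ 2 -> 0 <= u ->
  (u <= C / jap w ^+ 3 -> u <= C / (1 + t ^+ 2)) /\
  (u <= C / jap w ^+ 2 -> `|t| * u <= C).
Proof.
move=> tw u0; have j1 := jap_ge1 w; have j0 := jap_gt0 w; have t0 := oneDsqr_gt0 t.
have CP n : u <= C / jap w ^+ n -> 0 <= C.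
  by move=> /(le_trans u0); rewrite pmulr_lge0 // invr_gt0 exprn_gt0.
split=> h; have C0 := CP _ h.
  apply: le_trans h _; rewrite ler_wpM2l // lef_pV2 ?posrE ?exprn_gt0 //.
  by apply: le_trans tw _; apply: (ler_weXn2l j1).
apply: le_trans (ler_wpM2l (normr_ge0 _) h) _.
rewrite mulrCA; apply: ler_piMr => //; rewrite ler_pdivrMr ?exprn_gt0 // mul1r.
apply: le_trans tw; rewrite -[t ^+ 2]real_normK ?num_real //.
by have := sqr_ge0 (`|t| - 1); rewrite sqrrB; have := normr_ge0 t; nra.
Qed.

Lemma continuous_pair_l (b : R) : continuous (fun t : R => (t, b)).
Proof.
move=> t; exact: (@cvg_pair _ _ _ (nbhs t) (nbhs t) (nbhs b) _ _ _ id (cst b)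
  (@cvg_id _ _) (cvg_cst _)).
Qed.

Lemma continuous_pair_r (a : R) : continuous (fun t : R => (a, t)).
Proof.
move=> t; exact: (@cvg_pair _ _ _ (nbhs t) (nbhs a) (nbhs t) _ _ _ (cst a) id
  (cvg_cst _) (@cvg_id _ _)).
Qed.

(** By Fubini the integral is taken along horizontal lines first, and on each of them r is the
    derivative of a function that vanishes at both ends. With the vertical counterpart below, this
    is Stokes' theorem for decaying functions. *)
Lemma rI_derive_Re0 (G r : R[i] -> R) C : rcont r ->
  (forall a b : R, is_derive a 1 (fun t : R => G (t +i* b)) (r (a +i* b))) ->
  (forall w, `|r w| <= C / jap w ^+ 3) -> (forall w, `|G w| <= C / jap w ^+ 2) ->
  rI r = 0.
Proof.
move=> cr dG hr hG.
have ir : rint r by apply: (rint_dom cr (rintZ C rint_japV3)).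
rewrite /rI /Rintegral.
have -> // : (\int[mu2]_x (r (cpx x))%:E = 0)%E.
rewrite -(integral21_prod_meas1 ir) /=.
apply: integral0_eq => b _; rewrite /fubini_G /=.
have cl : continuous (fun t : R => r (t +i* b)).
  move=> t; apply: (@continuous_comp _ _ _ (fun t : R => (t, b)) (fun p => r (cpx p))).
    exact: continuous_pair_l.
  exact: cr.
have h1 (a : R) : `|r (a +i* b)| <= C / (1 + a ^+ 2).
  by apply: (decay_line C (jap_ge_Re (a +i* b)) (normr_ge0 _)).1; exact: hr.
have h2 (a : R) : `|a * G (a +i* b)| <= C.
  by rewrite normrM; apply: (decay_line C (jap_ge_Re (a +i* b)) (normr_ge0 _)).2; exact: hG.
by have [_] := integral_derive_decay cl (fun a => dG a b) h1 h2.
Qed.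

Lemma rI_derive_Im0 (G r : R[i] -> R) C : rcont r ->
  (forall a b : R, is_derive b 1 (fun t : R => G (a +i* t)) (r (a +i* b))) ->
  (forall w, `|r w| <= C / jap w ^+ 3) -> (forall w, `|G w| <= C / jap w ^+ 2) ->
  rI r = 0.
Proof.
move=> cr dG hr hG.
have ir : rint r by apply: (rint_dom cr (rintZ C rint_japV3)).
rewrite /rI /Rintegral.
have -> // : (\int[mu2]_x (r (cpx x))%:E = 0)%E.
rewrite -(integral12_prod_meas1 ir) /=.
apply: integral0_eq => a _; rewrite /fubini_F /=.
have cl : continuous (fun t : R => r (a +i* t)).
  move=> t; apply: (@continuous_comp _ _ _ (fun t : R => (a, t)) (fun p => r (cpx p))).
    exact: continuous_pair_r.
  exact: cr.
have h1 (b : R) : `|r (a +i* b)| <= C / (1 + b ^+ 2).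
  by apply: (decay_line C (jap_ge_Im (a +i* b)) (normr_ge0 _)).1; exact: hr.
have h2 (b : R) : `|b * G (a +i* b)| <= C.
  by rewrite normrM; apply: (decay_line C (jap_ge_Im (a +i* b)) (normr_ge0 _)).2; exact: hG.
by have [_] := integral_derive_decay cl (dG a) h1 h2.
Qed.

End PlaneIntegral.

(** * Derivatives along curves, growth orders, and Stokes' theorem for the antiholomorphic
    derivative *)

Section Dbar.
Variable R : realType.
Local Notation "x %:C" := (real_complex R x) (format "x %:C") : ring_scope.
Local Notation "x +i* y" := (Complex x y) : ring_scope.
Implicit Types (z w x e : R[i]) (g h : R[i] -> R[i]).

(** Functions on the plane are differentiated only along curves with a real parameter; horizontal
    and vertical lines then give the partial derivatives. *)
Definition cder (c : R -> R[i]) (t : R) (d : R[i]) :=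
  is_derive t 1 (fun s => complex.Re (c s)) (complex.Re d) /\
  is_derive t 1 (fun s => complex.Im (c s)) (complex.Im d).

Lemma cder_eq (c c' : R -> R[i]) t d d' : c =1 c' -> d = d' -> cder c t d -> cder c' t d'.
Proof. by move=> /funext -> ->. Qed.

Lemma cder_cst (a : R[i]) t : cder (fun=> a) t 0.
Proof. by split; exact: is_derive_cst. Qed.

Lemma cderD (c1 c2 : R -> R[i]) t d1 d2 : cder c1 t d1 -> cder c2 t d2 ->
  cder (fun s => c1 s + c2 s) t (d1 + d2).
Proof.
move=> [a1 b1] [a2 b2]; split.
  rewrite ReD (_ : (fun _ => _) = (fun s => complex.Re (c1 s) + complex.Re (c2 s))).
    exact: is_deriveD.
  by apply/funext => s; rewrite ReD.
rewrite ImD (_ : (fun _ => _) = (fun s => complex.Im (c1 s) + complex.Im (c2 s))).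
  exact: is_deriveD.
by apply/funext => s; rewrite ImD.
Qed.

Lemma cderM (c1 c2 : R -> R[i]) t d1 d2 : cder c1 t d1 -> cder c2 t d2 ->
  cder (fun s => c1 s * c2 s) t (d1 * c2 t + c1 t * d2).
Proof.
move=> [a1 b1] [a2 b2]; split.
  rewrite (_ : (fun _ => _) = (fun s => complex.Re (c1 s) * complex.Re (c2 s)
    - complex.Im (c1 s) * complex.Im (c2 s))).
    apply: (is_derive_eq (is_deriveB (is_deriveM a1 a2) (is_deriveM b1 b2))).
    by rewrite ReD !ReM /GRing.scale /=; ring.
  by apply/funext => s; rewrite ReM.
rewrite (_ : (fun _ => _) = (fun s => complex.Re (c1 s) * complex.Im (c2 s)
  + complex.Im (c1 s) * complex.Re (c2 s))).
  apply: (is_derive_eq (is_deriveD (is_deriveM a1 b2) (is_deriveM b1 a2))).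
  by rewrite ImD !ImM /GRing.scale /=; ring.
by apply/funext => s; rewrite ImM.
Qed.

Lemma cderX (c : R -> R[i]) t d n : cder c t d ->
  cder (fun s => c s ^+ n) t (n%:R * c t ^+ n.-1 * d).
Proof.
move=> dc; elim: n => [|n IH].
  by rewrite !mul0r; exact: cder_cst.
apply: (cder_eq _ _ (cderM dc IH)) => [s|]; first by rewrite exprS.
(* The truncated [n.-1] of the induction hypothesis singles out n = 0, where its coefficient is
   0. *)
case: n {IH} => [|n] /=; first by rewrite expr0 !mul0r mulr0 addr0 mulr1 mul1r mul1r.
by rewrite -[n.+2%:R]natr1 [c t ^+ n.+1]exprS; ring.
Qed.

Lemma cder_conj (c : R -> R[i]) t d : cder c t d -> cder (fun s => (c s)^*) t d^*.
Proof.
move=> [a b]; split.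
  rewrite (_ : (fun _ => _) = (fun s => complex.Re (c s))); last first.
    by apply/funext => s; case: (c s).
  by rewrite (_ : complex.Re d^* = complex.Re d) //; case: (d).
rewrite (_ : (fun _ => _) = (fun s => - complex.Im (c s))); last first.
  by apply/funext => s; case: (c s).
rewrite (_ : complex.Im d^* = - complex.Im d); last by case: (d).
exact: is_deriveN.
Qed.

(** Complex-valued so that it multiplies kernels directly; the density of iota_n is (n + 1) / pi
    times its power n + 2 ([iota_densE]). *)
Definition wgt w : R[i] := ((1 + abs2 w)^-1)%:C.

Lemma wgtK w : wgt w * (1 + w * w^*) = 1.
Proof.
rewrite /wgt -abs2E -(rmorph1 (real_complex R)) -rmorphD /= -rmorphM /= mulVf //.
exact: lt0r_neq0 (oneDabs2_gt0 w).
Qed.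

Lemma wgtE w : w * w^* * wgt w = 1 - wgt w.
Proof. by rewrite -(wgtK w); ring. Qed.

Lemma cnorm_wgt w : cnorm (wgt w) = (jap w ^+ 2)^-1.
Proof. by rewrite cnorm_real jap_sqr ger0_norm // invr_ge0 ltW // oneDabs2_gt0. Qed.

(** The derivative of [wgt] at w in the direction e: the factor w conj(e) + conj(w) e is that of
    |w|^2. *)
Definition dwgt e w := - (wgt w ^+ 2) * (w * e^* + w^* * e).

Lemma cder_wgt (c : R -> R[i]) t d : cder c t d ->
  cder (fun s => wgt (c s)) t (dwgt d (c t)).
Proof.
move=> [a b].
have h : is_derive t 1 (fun s => 1 + abs2 (c s))
    (2 * (complex.Re (c t) * complex.Re d + complex.Im (c t) * complex.Im d)).
  have h1 := is_deriveD (is_deriveM a a) (is_deriveM b b).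
  have h2 := @is_deriveD _ _ _ (cst (1 : R)) _ t 1 _ _ (is_derive_cst _ _ _) h1.
  by apply: (is_derive_eq h2); rewrite /GRing.scale /=; ring.
have n0 := lt0r_neq0 (oneDabs2_gt0 (c t)).
have hv := @is_deriveV _ (fun s => 1 + abs2 (c s)) t _ 1 n0 h.
have -> : dwgt d (c t) = (- ((1 + abs2 (c t)) ^+ 2)^-1 *
    (2 * (complex.Re (c t) * complex.Re d + complex.Im (c t) * complex.Im d)))%:C.
  rewrite /dwgt /wgt -rmorphXn /= exprVn; case: (c t) => p q; case: (d) => u v /=.
  by simpc; congr (_ +i* _); ring.
by split => //=; exact: is_derive_cst.
Qed.

Lemma cder_lineRe (b t : R) : cder (fun s => s +i* b) t 1.
Proof. by split => /=; [exact: is_derive_id|exact: is_derive_cst]. Qed.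

Lemma cder_lineIm (a t : R) : cder (fun s => a +i* s) t 'i%C.
Proof. by split => /=; [exact: is_derive_cst|exact: is_derive_id]. Qed.

(* [adm p q g]: g is continuous and O(|w| ^ (q - p)) at infinity. *)
Definition adm (p q : nat) g :=
  ccont g /\ exists2 C : R, 0 <= C & forall w, cnorm (g w) * jap w ^+ p <= C * jap w ^+ q.

Lemma adm_eq p q g h : g =1 h -> adm p q g -> adm p q h.
Proof. by move=> /funext ->. Qed.

Lemma adm_cst c : adm 0 0 (fun=> c).
Proof.
split; first exact: ccont_cst.
by exists (cnorm c) => [|w]; [exact: cnorm_ge0|rewrite expr0].
Qed.

Lemma adm_id : adm 0 1 id.
Proof.
split; first exact: ccont_id.
by exists 1 => // w; rewrite expr0 mulr1 mul1r expr1 cnorm_le_jap.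
Qed.

Lemma adm_conj p q g : adm p q g -> adm p q (fun w => (g w)^*).
Proof.
move=> [cg [C C0 hC]]; split; first exact: ccont_conj.
by exists C => // w; rewrite cnormJ.
Qed.

Lemma adm_wgt : adm 2 0 wgt.
Proof.
split; first by apply: ccont_real; exact: rcont_oneDabs2V.
exists 1 => // w; rewrite cnorm_wgt mulVf ?mulr1 // expf_neq0 //.
exact: lt0r_neq0 (jap_gt0 w).
Qed.

(** Only the order q - p counts, and it may grow because [jap] is at least 1. The condition avoids
    truncated subtraction, which leaves it to [lia]. *)
Lemma admW p q p' q' g : (q + p' <= q' + p)%N -> adm p q g -> adm p' q' g.
Proof.
move=> le [cg [C C0 hC]]; split => //; exists C => // w.
have j0 := jap_gt0 w; have j1 := jap_ge1 w.
rewrite -(ler_pM2r (exprn_gt0 p j0)) mulrAC.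
apply: le_trans (ler_wpM2r _ (hC w)) _; first by rewrite exprn_ge0 // ltW.
rewrite -!mulrA -!exprD; apply: ler_wpM2l => //; exact: (ler_weXn2l j1 le).
Qed.

Lemma admM p q p' q' g h : adm p q g -> adm p' q' h ->
  adm (p + p') (q + q') (fun w => g w * h w).
Proof.
move=> [cg [C C0 hC]] [ch [D D0 hD]]; split; first exact: ccontM.
exists (C * D) => [|w]; first exact: mulr_ge0.
rewrite cnormM !exprD mulrACA [X in _ <= X]mulrACA.
by apply: ler_pM => //; rewrite mulr_ge0 ?cnorm_ge0 // exprn_ge0 // ltW // jap_gt0.
Qed.

Lemma admD p q g h : adm p q g -> adm p q h -> adm p q (fun w => g w + h w).
Proof.
move=> [cg [C C0 hC]] [ch [D D0 hD]]; split; first exact: ccontD.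
exists (C + D) => [|w]; first exact: addr_ge0.
rewrite mulrDl; apply: le_trans (lerD (hC w) (hD w)); rewrite -mulrDl.
by apply: ler_wpM2r; [rewrite exprn_ge0 // ltW // jap_gt0|exact: cnormD].
Qed.

Lemma admX p q g n : adm p q g -> adm (n * p) (n * q) (fun w => g w ^+ n).
Proof.
move=> ag; elim: n => [|n IH]; first exact: adm_cst.
by apply: adm_eq (admM ag IH) => w; rewrite exprS.
Qed.

Lemma admZ p q g c : adm p q g -> adm p q (fun w => c * g w).
Proof. by move=> ag; exact: admM (adm_cst c) ag. Qed.

Lemma admN p q g : adm p q g -> adm p q (fun w => - g w).
Proof. by move=> /(admZ (-1)); apply: adm_eq => w; rewrite mulN1r. Qed.

Lemma adm_kerl z : adm 0 1 (fun w => 1 + w * z^*).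
Proof.
apply: admD; first exact: admW (adm_cst _).
by apply: adm_eq (admZ z^* adm_id) => w; rewrite mulrC.
Qed.

Lemma adm_kerr x : adm 0 1 (fun w => 1 + x * w^*).
Proof.
apply: admD; first exact: admW (adm_cst _).
by apply: admZ; exact: adm_conj adm_id.
Qed.

Lemma adm_bound p g : adm p 0 g -> exists C, forall w, cnorm (g w) <= C / jap w ^+ p.
Proof.
move=> [cg [C C0 hC]]; exists C => w; rewrite ler_pdivlMr ?exprn_gt0 ?jap_gt0 //.
by have := hC w; rewrite expr0 mulr1.
Qed.

Lemma adm_cint g : adm 3 0 g -> cint g.
Proof. by move=> ag; have [C hC] := adm_bound ag; apply: (cint_jap _ hC); case: ag. Qed.

(** The integrand is twice the antiholomorphic derivative of G, as [dG 1] and [dG 'i] are the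
    partial derivatives. Each of these integrates to 0, by [rI_derive_Re0] or [rI_derive_Im0] on
    real and imaginary parts. *)
Lemma cintA_dbar0 (G : R[i] -> R[i]) (dG : R[i] -> R[i] -> R[i]) :
  (forall e, adm 3 0 (dG e)) -> adm 2 0 G ->
  (forall c t d, cder c t d -> cder (fun s => G (c s)) t (dG d (c t))) ->
  cintA (fun w => dG 1 w + 'i%C * dG 'i%C w) = 0.
Proof.
move=> adG aG hG.
have part e : e = 1 \/ e = 'i%C -> cintA (dG e) = 0.
  move=> he; have [C hC] := adm_bound aG; have [D hD] := adm_bound (adG e).
  have [[c1 c2] _] := adG e.
  (* One constant has to serve both decay hypotheses of [rI_derive_Re0] and [rI_derive_Im0]. *)
  pose M := Num.max C D.
  have hC' w : cnorm (G w) <= M / jap w ^+ 2.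
    apply: le_trans (hC w) _; rewrite ler_wpM2r //; last by rewrite le_max lexx.
    by rewrite invr_ge0 exprn_ge0 // ltW // jap_gt0.
  have hD' w : cnorm (dG e w) <= M / jap w ^+ 3.
    apply: le_trans (hD w) _; rewrite ler_wpM2r //; last by rewrite le_max lexx orbT.
    by rewrite invr_ge0 exprn_ge0 // ltW // jap_gt0.
  have r1 w := le_trans (Re_le_cnorm _) (hC' w).
  have r2 w := le_trans (Im_le_cnorm _) (hC' w).
  have r3 w := le_trans (Re_le_cnorm _) (hD' w).
  have r4 w := le_trans (Im_le_cnorm _) (hD' w).
  rewrite cintAE; case: he => he; subst e.
    rewrite (rI_derive_Re0 (G := fun w => complex.Re (G w)) c1 _ r3 r1); last first.
      by move=> a b; case: (hG _ _ _ (cder_lineRe b a)).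
    rewrite (rI_derive_Re0 (G := fun w => complex.Im (G w)) c2 _ r4 r2) //.
    by move=> a b; case: (hG _ _ _ (cder_lineRe b a)).
  rewrite (rI_derive_Im0 (G := fun w => complex.Re (G w)) c1 _ r3 r1); last first.
    by move=> a b; case: (hG _ _ _ (cder_lineIm a b)).
  rewrite (rI_derive_Im0 (G := fun w => complex.Im (G w)) c2 _ r4 r2) //.
  by move=> a b; case: (hG _ _ _ (cder_lineIm a b)).
rewrite cintAD; last 2 first.
- exact: adm_cint.
- by apply: cintZ; exact: adm_cint.
rewrite cintAZ; last exact: adm_cint.
by rewrite !part; [rewrite mulr0 addr0|right|left].
Qed.

End Dbar.

(** * The reproducing property and the normalisation of iota_n *)

Section ReproducingKernel.
Variable R : realType.
Local Notation "x %:C" := (real_complex R x) (format "x %:C") : ring_scope.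
Implicit Types (z w x e : R[i]) (g h : R[i] -> R[i]).

Definition kquot x w : R[i] := (1 + x * w^*) * wgt w.
Definition dkquot x e w := x * e^* * wgt w + (1 + x * w^*) * dwgt e w.

Lemma adm_kquot x : adm 2 1 (kquot x).
Proof. exact: (admM (adm_kerr x) (adm_wgt R)). Qed.

Lemma adm_dwgt e : adm 4 1 (dwgt e).
Proof.
apply: (@admM _ (2 * 2)%N 0 0 1).
  by apply: admN; exact: (admX 2 (adm_wgt R)).
apply: admD.
  by apply: adm_eq (admZ e^* (adm_id R)) => w; rewrite mulrC.
by apply: adm_eq (admZ e (adm_conj (adm_id R))) => w; rewrite mulrC.
Qed.

Lemma adm_dkquot x e : adm 2 0 (dkquot x e).
Proof.
apply: admD; first by apply: admZ; exact: adm_wgt.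
exact: (@admW _ 4 2 2 0 _ isT (admM (adm_kerr x) (adm_dwgt e))).
Qed.

Lemma cder_kquot x (c : R -> R[i]) t d : cder c t d ->
  cder (fun s => kquot x (c s)) t (dkquot x d (c t)).
Proof.
move=> dc.
have d1 := cderD (cder_cst 1 t) (cderM (cder_cst x t) (cder_conj dc)).
by apply: (cder_eq _ _ (cderM d1 (cder_wgt dc))) => //; rewrite /dkquot; ring.
Qed.

(* [kquot x] plays the role of a primitive: its antiholomorphic derivative is
   [(x - w) * wgt w ^+ 2]. *)
Lemma cintA_kernel_vanish i n x z : (i < n)%N ->
  cintA (fun w => (w - x) * ((1 + w * z^*) ^+ i * ((1 + x * w^*) ^+ n * wgt w ^+ n.+2))) = 0.
Proof.
move=> lt_in.
(* The first factor is holomorphic, hence inert under the antiholomorphic derivative. The order of G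
   is i - n - 1, which i < n makes at most -2. *)
pose G w := (1 + w * z^*) ^+ i * kquot x w ^+ n.+1.
pose dG e w := i%:R * (1 + w * z^*) ^+ i.-1 * (e * z^*) * kquot x w ^+ n.+1 +
  (1 + w * z^*) ^+ i * (n.+1%:R * kquot x w ^+ n * dkquot x e w).
have aG : adm 2 0 G.
  apply: admW (admM (admX i (adm_kerl z)) (admX n.+1 (adm_kquot x))); lia.
have adG e : adm 3 0 (dG e).
  apply: admD.
    (* For i = 0 the truncated [i.-1] would spoil the order count, but the coefficient makes the
       whole term 0. *)
    case: i lt_in {G dG aG} => [|i] lt_in.
      apply: (@adm_eq _ _ _ (fun=> 0)) => [w|]; first by rewrite !mul0r.
      apply: (@adm_eq _ _ _ (fun w => 0 * wgt w ^+ 2)) => [w|]; first by rewrite mul0r.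
      by apply: admW (admZ 0 (admX 2 (adm_wgt R))).
    apply: (@adm_eq _ _ _ (fun w => (i.+1%:R * (e * z^*)) *
      ((1 + w * z^*) ^+ i * kquot x w ^+ n.+1))) => [w|]; first by rewrite /=; ring.
    by apply: admZ; apply: admW (admM (admX i (adm_kerl z)) (admX n.+1 (adm_kquot x))); lia.
  apply: (@adm_eq _ _ _ (fun w => n.+1%:R * ((1 + w * z^*) ^+ i * (kquot x w ^+ n *
      dkquot x e w)))) => [w|]; first by ring.
  apply: admZ; apply: admW (admM (admX i (adm_kerl z))
    (admM (admX n (adm_kquot x)) (adm_dkquot x e))); lia.
have hG c t d : cder c t d -> cder (fun s => G (c s)) t (dG d (c t)).
  move=> dc; have d1 := cderD (cder_cst 1 t) (cderM dc (cder_cst z^* t)).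
  apply: (cder_eq _ _ (cderM (cderX i d1) (cderX n.+1 (cder_kquot x dc)))) => //.
  by rewrite /dG /=; ring.
have := cintA_dbar0 adG aG hG.
set H := fun w => (w - x) * _.
(* Twice the antiholomorphic derivative of G is -2 (n + 1) H: pulling out i * i = -1 cancels the
   holomorphic contributions, and [wgtE] eliminates |w|^2 from the rest. *)
rewrite (@eq_cintA _ _ (fun w => (- 2 * n.+1%:R) * H w)); last first.
  move=> w; rewrite /dG /H /dkquot /dwgt.
  have E : (1 + x * w^*) ^+ n * wgt w ^+ n.+2 = kquot x w ^+ n * wgt w ^+ 2.
    by rewrite /kquot exprMn -[n.+2]addn2 exprD mulrA.
  rewrite E; have W := wgtE w.
  have i2 : ('i%C : R[i]) * 'i%C = -1 by rewrite -expr2 sqr_i.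
  have ci : ('i%C : R[i])^* = - 'i%C by simpc.
  have c1 : (1 : R[i])^* = 1 by rewrite conjC1.
  rewrite c1 ci.
  transitivity (2 * n.+1%:R * (1 + w * z^*) ^+ i * kquot x w ^+ n *
     (x * wgt w - (1 + x * w^*) * (wgt w ^+ 2 * w))).
    set k1 := kquot x w ^+ n.+1; set k0 := kquot x w ^+ n; set u := (1 + w * z^*) ^+ i.
    set u' := (1 + w * z^*) ^+ i.-1.
    have -> : ('i%C : R[i]) * (i%:R * u' * ('i%C * z^*) * k1 +
       u * (n.+1%:R * k0 * (x * - 'i%C * wgt w + (1 + x * w^*) *
         (- wgt w ^+ 2 * (w * - 'i%C + w^* * 'i%C))))) =
      ('i%C * 'i%C) * (i%:R * u' * z^* * k1 +
       u * (n.+1%:R * k0 * (x * - 1 * wgt w + (1 + x * w^*) *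
         (- wgt w ^+ 2 * (w * - 1 + w^*))))) by ring.
    by rewrite i2; ring.
  have -> : x * wgt w - (1 + x * w^*) * (wgt w ^+ 2 * w) =
     x * wgt w - wgt w ^+ 2 * w - x * wgt w * (w * w^* * wgt w) by ring.
  by rewrite W; ring.
rewrite cintAZ; last first.
  apply: adm_cint; rewrite /H.
  have a1 : adm 0 1 (fun w => w - x).
    by apply: admD; [exact: adm_id|exact: admW (adm_cst _)].
  apply: admW (admM a1 (admM (admX i (adm_kerl z))
    (admM (admX n (adm_kerr x)) (admX n.+2 (adm_wgt R))))); lia.
move=> /eqP; rewrite mulf_eq0 => /orP[|/eqP //].
by rewrite mulf_eq0 oppr_eq0 !pnatr_eq0.
Qed.

(** Up to the factor (n + 1) / pi, the total mass of iota_n. *)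
Definition mass n : R[i] := cintA (fun w : R[i] => wgt w ^+ n.+2).

(** The difference of the n-th powers of 1 + w conj(z) and 1 + x conj(z) factors as (w - x) conj(z)
    times a sum of products with powers i < n of 1 + w conj(z). Each summand integrates to 0 by
    [cintA_kernel_vanish]. *)
Lemma cintA_kernel2 n x z :
  cintA (fun w => (1 + w * z^*) ^+ n * ((1 + x * w^*) ^+ n * wgt w ^+ n.+2)) =
  (1 + x * z^*) ^+ n * cintA (fun w => (1 + x * w^*) ^+ n * wgt w ^+ n.+2).
Proof.
have i1 i : (i <= n)%N -> cint (fun w => (1 + w * z^*) ^+ i * ((1 + x * w^*) ^+ n * wgt w ^+ n.+2)).
  move=> le; apply: adm_cint; apply: admW (admM (admX i (adm_kerl z))
    (admM (admX n (adm_kerr x)) (admX n.+2 (adm_wgt R)))); lia.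
have i2 : cint (fun w => (1 + x * w^*) ^+ n * wgt w ^+ n.+2).
  by apply: eq_cint (i1 0%N isT) => w; rewrite expr0 mul1r.
apply/eqP; rewrite -subr_eq0 -mulNr -cintAZ // -cintAD //; last 2 first.
- exact: i1.
- exact: cintZ.
pose H (i : 'I_n) w := (z^* * (1 + x * z^*) ^+ (n.-1 - i)) * ((w - x) *
  ((1 + w * z^*) ^+ i * ((1 + x * w^*) ^+ n * wgt w ^+ n.+2))).
have iH i : cint (fun w => (w - x) * ((1 + w * z^*) ^+ i * ((1 + x * w^*) ^+ n * wgt w ^+ n.+2))) \/ (n <= i)%N.
  case: (ltnP i n) => [lt|]; [left|by right].
  apply: adm_cint.
  have a1 : adm 0 1 (fun w => w - x).
    by apply: admD; [exact: adm_id|exact: admW (adm_cst _)].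
  apply: admW (admM a1 (admM (admX i (adm_kerl z))
    (admM (admX n (adm_kerr x)) (admX n.+2 (adm_wgt R))))); lia.
rewrite (@eq_cintA _ _ (fun w => \sum_(i < n) H i w)); last first.
  move=> w; rewrite mulNr -mulrBl -opprB subrXX.
  have -> : 1 + x * z^* - (1 + w * z^*) = - ((w - x) * z^*) by ring.
  rewrite !mulNr opprK mulr_sumr mulr_suml; apply: eq_bigr => i _.
  by rewrite /H; ring.
rewrite cintA_sum => [|i]; last first.
  by apply: cintZ; case: (iH i) => //; rewrite leqNgt ltn_ord.
rewrite big1 // => i _; rewrite /H cintAZ; last first.
  by case: (iH i) => //; rewrite leqNgt ltn_ord.
by rewrite cintA_kernel_vanish // mulr0.
Qed.

Lemma cint_wgt n : cint (fun w : R[i] => wgt w ^+ n.+2).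
Proof. apply: adm_cint; apply: admW (admX n.+2 (adm_wgt R)); lia. Qed.

Lemma wgt_conj w : (wgt w)^* = wgt w.
Proof. exact: conj_real. Qed.

Lemma mass_real n : mass n = (rI (fun w : R[i] => (1 + abs2 w)^-1 ^+ n.+2))%:C.
Proof.
rewrite -cintA_real; apply: eq_cintA => w.
by rewrite /wgt -rmorphXn.
Qed.

(** [cintA_kernel2] with evaluation point 0 settles the holomorphic kernel, a mean value property;
    conjugation carries this over, the mass being real. *)
Lemma cintA_kernel1 n x :
  cintA (fun w => (1 + x * w^*) ^+ n * wgt w ^+ n.+2) = mass n.
Proof.
have h : cintA (fun w => (1 + w * x^*) ^+ n * wgt w ^+ n.+2) = mass n.
  have e1 : cintA (fun w => (1 + 0 * w^*) ^+ n * wgt w ^+ n.+2) = mass n.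
    by apply: eq_cintA => w; rewrite mul0r addr0 expr1n mul1r.
  have := cintA_kernel2 n 0 x; rewrite e1 mul0r addr0 expr1n mul1r => <-.
  by apply: eq_cintA => w; rewrite mul0r addr0 expr1n mul1r.
have ic : cint (fun w => (1 + w * x^*) ^+ n * wgt w ^+ n.+2).
  apply: adm_cint; apply: admW (admM (admX n (adm_kerl x)) (admX n.+2 (adm_wgt R))); lia.
have := cintA_conj ic; rewrite h mass_real conj_real => <-.
apply: eq_cintA => w; rewrite rmorphM !rmorphXn /= wgt_conj.
by rewrite rmorphD rmorphM /= conjCK conjC1 mulrC [w^* * x]mulrC mulrC.
Qed.

(** By Tonelli: [integral_sqDV2] gives pi / 2 times (1 + a^2)^(-3/2) for the inner integral, and
    [integral_japV3] contributes 2. *)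
Lemma mass0 : mass 0 = (pi : R)%:C.
Proof.
rewrite mass_real; congr (_%:C); rewrite /rI /Rintegral.
have -> // : (\int[@lebesgue_measure R \x @lebesgue_measure R]_p
   ((1 + abs2 (cpx p))^-1 ^+ 2)%:E = pi%:E)%E.
have mm : measurable_fun setT (EFin \o (fun p : R * R => (1 + abs2 (cpx p))^-1 ^+ 2)).
  apply/measurable_EFinP; apply: continuous_prod_measurable_fun.
  by apply: (@rcontX R (fun w => (1 + abs2 w)^-1)); exact: rcont_oneDabs2V.
rewrite fubini_tonelli1 /=; last 2 first.
- exact: mm.
- by move=> p; rewrite lee_fin exprn_ge0 // invr_ge0 ltW // oneDabs2_gt0.
rewrite /fubini_F /=.
under eq_integral => a _.
  under eq_integral => b _.
    rewrite /abs2 /cpx /= exprVn addrA.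
    rewrite -[1 + a ^+ 2](@sqr_sqrtr R); last by rewrite ltW // oneDsqr_gt0.
    over.
  rewrite /= integral_sqDV2; last by rewrite sqrtr_gt0 oneDsqr_gt0.
  rewrite EFinM.
  over.
rewrite ge0_integralZl//; last 2 first.
- by apply/measurable_EFinP; apply: continuous_measurable_fun; exact: continuous_japV3.
- by rewrite lee_fin divr_ge0 // pi_ge0.
by rewrite integral_japV3 -EFinM; congr EFin; field.
Qed.

(** Stokes' theorem for conj(w) [wgt w ^+ n.+2], whose antiholomorphic derivative is -(n + 1)
    [wgt w ^+ n.+2] + (n + 2) [wgt w ^+ n.+3]. *)
Lemma massS n : n.+2%:R * mass n.+1 = n.+1%:R * mass n.
Proof.
pose G w : R[i] := w^* * wgt w ^+ n.+2.
pose dG e w : R[i] := e^* * wgt w ^+ n.+2 + w^* * (n.+2%:R * wgt w ^+ n.+1 * dwgt e w).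
have aG : adm 2 0 G.
  apply: admW (admM (adm_conj (adm_id R)) (admX n.+2 (adm_wgt R))); lia.
have adG e : adm 3 0 (dG e).
  apply: admD; first by apply: admZ; apply: admW (admX n.+2 (adm_wgt R)); lia.
  apply: (@adm_eq _ _ _ (fun w => n.+2%:R * (w^* * (wgt w ^+ n.+1 * dwgt e w)))) => [w|].
    by ring.
  apply: admZ; apply: admW (admM (adm_conj (adm_id R)) (admM (admX n.+1 (adm_wgt R)) (adm_dwgt e))); lia.
have hG c t d : cder c t d -> cder (fun s => G (c s)) t (dG d (c t)).
  by move=> dc; apply: (cder_eq _ _ (cderM (cder_conj dc) (cderX n.+2 (cder_wgt dc)))).
have := cintA_dbar0 adG aG hG.
rewrite (@eq_cintA _ _ (fun w => (- 2 * n.+1%:R) * wgt w ^+ n.+2 + (2 * n.+2%:R) * wgt w ^+ n.+3)).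
  rewrite cintAD; [|by apply: cintZ; exact: cint_wgt..].
  rewrite !cintAZ; [|exact: cint_wgt..].
  rewrite -/(mass n) -/(mass n.+1) => h.
  have two0 : (2 : R[i]) != 0 by rewrite pnatr_eq0.
  apply: (mulfI two0); apply/eqP; rewrite -subr_eq0 -{}h; apply/eqP; ring.
move=> w; rewrite /dG /dwgt.
have ci : ('i%C : R[i])^* = - 'i%C by simpc.
have i2 : ('i%C : R[i]) * 'i%C = -1 by rewrite -expr2 sqr_i.
have c1 : (1 : R[i])^* = 1 by rewrite conjC1.
  rewrite c1 ci.
have -> : ('i%C : R[i]) * (- 'i%C * wgt w ^+ n.+2 + w^* * (n.+2%:R * wgt w ^+ n.+1 *
    (- wgt w ^+ 2 * (w * - 'i%C + w^* * 'i%C)))) =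
   ('i%C * 'i%C) * (- wgt w ^+ n.+2 + w^* * (n.+2%:R * wgt w ^+ n.+1 *
    (- wgt w ^+ 2 * (- w + w^*)))) by ring.
rewrite i2.
transitivity (2 * wgt w ^+ n.+2 - 2 * n.+2%:R * wgt w ^+ n.+2 * (w * w^* * wgt w)).
  by rewrite [wgt w ^+ n.+2]exprS; ring.
by rewrite wgtE [wgt w ^+ n.+3]exprS -[n.+2%:R]natr1; ring.
Qed.

Lemma massE n : mass n = (pi / n.+1%:R)%:C.
Proof.
elim: n => [|n IH]; first by rewrite mass0 divr1.
have n0 : (n.+2%:R : R[i]) != 0 by rewrite pnatr_eq0.
apply: (mulfI n0); rewrite massS IH -!(rmorph_nat (real_complex R)) -!rmorphM /=.
by congr (_%:C); rewrite mulrC divfK ?pnatr_eq0 // mulrC divfK ?pnatr_eq0.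
Qed.

Lemma iota_densE n w : (iota_dens n w)%:C = (n.+1%:R / pi)%:C * wgt w ^+ n.+2.
Proof.
rewrite /wgt -rmorphXn -rmorphM /=; congr (_%:C); rewrite /iota_dens exprVn.
have w0 := lt0r_neq0 (oneDabs2_gt0 w); have p0 := lt0r_neq0 (@pi_gt0 R).
move: (pi) p0 => P p0; rewrite -[n.+2]addn2 exprD; field.
by rewrite w0 p0 expf_neq0.
Qed.

(** [cintA_kernel2] evaluates the kernel at x, [cintA_kernel1] computes the integral that is left,
    and [massE] shows that the constant (n + 1) / pi normalises it to 1. *)
Theorem reproducing n x z :
  iota_int n (fun w => (1 + w * z^*) ^+ n * (1 + x * w^*) ^+ n) = (1 + x * z^*) ^+ n.
Proof.
rewrite /iota_int (@eq_cintA _ _ (fun w => (n.+1%:R / pi)%:C *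
  ((1 + w * z^*) ^+ n * ((1 + x * w^*) ^+ n * wgt w ^+ n.+2)))); last first.
  by move=> w; rewrite iota_densE; ring.
rewrite cintAZ; last first.
  apply: adm_cint; apply: admW (admM (admX n (adm_kerl z))
    (admM (admX n (adm_kerr x)) (admX n.+2 (adm_wgt R)))); lia.
rewrite cintA_kernel2 cintA_kernel1 massE mulrCA -rmorphM /=.
have -> : n.+1%:R / pi * (pi / n.+1%:R) = 1 :> R.
  by rewrite mulrA divfK ?lt0r_neq0 ?pi_gt0 // divff ?pnatr_eq0.
by rewrite mulr1.
Qed.

End ReproducingKernel.

(** * Uniform bounds for Toeplitz operators in the weighted sup norm *)

Section Toeplitz.
Variable R : realType.
Local Notation "x %:C" := (real_complex R x) (format "x %:C") : ring_scope.
Implicit Types (z w x : R[i]) (F g h : R[i] -> R[i]).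

Lemma iota_dens_jap n w : iota_dens n w = n.+1%:R / pi * (jap w ^+ (n.*2 + 4))^-1.
Proof.
rewrite -muln2 -[4%N]/(2 * 2)%N -mulnDl mulnC exprM jap_sqr -exprVn /iota_dens exprVn.
have w0 := lt0r_neq0 (oneDabs2_gt0 w); have p0 := lt0r_neq0 (@pi_gt0 R).
move: (pi) p0 => P p0; rewrite exprD; field.
by rewrite w0 p0 expf_neq0.
Qed.

Lemma iota_dens_ge0 n w : 0 <= iota_dens n w.
Proof.
rewrite iota_dens_jap mulr_ge0 // ?divr_ge0 ?pi_ge0 // invr_ge0 exprn_ge0 //.
exact/ltW/jap_gt0.
Qed.

Lemma adm_dens n : adm (n.*2 + 4) 0 (fun w => (iota_dens n w)%:C).
Proof.
apply: (@adm_eq _ _ _ (fun w => (n.+1%:R / pi)%:C * wgt w ^+ n.+2)) => [w|].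
  by rewrite iota_densE.
apply: admZ; apply: admW (admX n.+2 (adm_wgt R)); lia.
Qed.

Lemma rcont_dens n : rcont (@iota_dens R n).
Proof. by case: (adm_dens n) => [[]]. Qed.

Lemma conj_kernel x w : (1 + x * w^*)^* = 1 + w * x^*.
Proof. by rewrite rmorphD rmorphM /= conjCK conjC1 mulrC. Qed.

(** The reproducing property at z = x: the squared norm of the kernel function at x is K^m(x, x). *)
Lemma rI_kernel_sqr m x :
  rint (fun w => abs2 (1 + x * w^*) ^+ m * iota_dens m w) /\
  rI (fun w => abs2 (1 + x * w^*) ^+ m * iota_dens m w) = jap x ^+ m.*2.
Proof.
pose r w := abs2 (1 + x * w^*) ^+ m * iota_dens m w.
have E w : (1 + w * x^*) ^+ m * (1 + x * w^*) ^+ m * (iota_dens m w)%:C = (r w)%:C.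
  rewrite /r [RHS]rmorphM /= rmorphXn /= abs2E conj_kernel exprMn.
  by rewrite [_ ^+ m * _ ^+ m]mulrC.
have ic : cint (fun w => (r w)%:C).
  apply: eq_cint E _; apply: adm_cint.
  apply: admW (admM (admM (admX m (adm_kerl x)) (admX m (adm_kerr x))) (adm_dens m)); lia.
split; first by case: ic.
have := reproducing m x x; rewrite /iota_int (eq_cintA E) cintA_real.
rewrite -abs2E -(rmorph1 (real_complex R)) -rmorphD /= -rmorphXn /= => /complexI ->.
by rewrite -jap_sqr -exprM mul2n.
Qed.

(* For even n this is the reproducing property for the exponent n/2, since
   |1 + x conj(w)| ^ n is the squared modulus of its kernel; an odd n costs one
   extra Cauchy-Schwarz factor. *)
Lemma schur_bound n x :
  rint (fun w => cnorm (1 + x * w^*) ^+ n * jap w ^+ n * iota_dens n w) /\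
  rI (fun w => cnorm (1 + x * w^*) ^+ n * jap w ^+ n * iota_dens n w) <= 2 * jap x ^+ n.
Proof.
pose m := n./2; pose b : nat := odd n.
have nE : n = (b + m.*2)%N by rewrite /b /m odd_double_half.
have [ir rE] := rI_kernel_sqr m x.
pose r w := cnorm (1 + x * w^*) ^+ n * jap w ^+ n * iota_dens n w.
have r0 w : 0 <= r w.
  rewrite mulr_ge0 ?iota_dens_ge0 // mulr_ge0 // exprn_ge0 ?cnorm_ge0 ?jap_ge0 //.
(* The factor 2 absorbs the ratio of the normalising constants of iota_n and iota_m, as n + 1 <= 2
   (m + 1); the factor [jap x ^+ b] is present only for odd n. *)
have le_r w : r w <= (2 * jap x ^+ b) * (abs2 (1 + x * w^*) ^+ m * iota_dens m w).
  rewrite /r !iota_dens_jap -cnorm_sqr -exprM mul2n.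
  set c := cnorm _; set j := jap w; set X := jap x.
  have c0 : 0 <= c by exact: cnorm_ge0.
  have j0 : 0 < j by exact: jap_gt0.
  have X0 : 0 < X by exact: jap_gt0.
  have cX : c <= j * X.
    by rewrite /c -cnormJ conj_kernel kernel_le_jap.
  have -> : c ^+ n * j ^+ n * (n.+1%:R / pi / j ^+ (n.*2 + 4)) =
      (c / j) ^+ b * (c ^+ m.*2 * (n.+1%:R / pi / j ^+ (m.*2 + 4))).
    have -> : j ^+ (n.*2 + 4) = j ^+ n * (j ^+ b * j ^+ (m.*2 + 4)).
      by rewrite -!exprD; congr (_ ^+ _); lia.
    have jn : j ^+ n != 0 by rewrite expf_neq0 // lt0r_neq0.
    have jb : j ^+ b != 0 by rewrite expf_neq0 // lt0r_neq0.
    have jm : j ^+ (m.*2 + 4) != 0 by rewrite expf_neq0 // lt0r_neq0.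
    have p0 := lt0r_neq0 (@pi_gt0 R).
    rewrite {1}nE exprD expr_div_n.
    move: (pi) p0 (j ^+ n) jn (j ^+ b) jb (j ^+ (m.*2 + 4)) jm (c ^+ b) (c ^+ m.*2).
    by move=> P p0 J1 n1 J2 n2 J3 n3 c1 c2; field; rewrite n1 n2 n3 p0.
  have -> : 2 * X ^+ b * (c ^+ m.*2 * (m.+1%:R / pi / j ^+ (m.*2 + 4))) =
     X ^+ b * (c ^+ m.*2 * ((2 * m.+1%:R) / pi / j ^+ (m.*2 + 4))) by ring.
  apply: ler_pM.
  - by rewrite exprn_ge0 // divr_ge0 // ltW.
  - by rewrite !mulr_ge0 ?invr_ge0 ?exprn_ge0 ?pi_ge0 // ltW.
  - apply: lerXn2r; rewrite ?nnegrE; [by rewrite divr_ge0 // ltW|exact: ltW|].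
    by rewrite ler_pdivrMr // mulrC.
  - rewrite ler_wpM2l ?exprn_ge0 // ler_wpM2r ?invr_ge0 ?exprn_ge0 ?(ltW j0) //.
    rewrite ler_wpM2r ?invr_ge0 ?pi_ge0 // -natrM ler_nat; lia.
have cr : rcont r.
  have c1 : rcont (fun w => cnorm (1 + x * w^*)).
    by apply: rcont_cnorm; case: (adm_kerr x).
  exact: (rcontM (rcontM (@rcontX R _ n c1) (@rcontX R _ n (@rcont_jap R))) (@rcont_dens n)).
have irr : rint r.
  apply: (rint_dom cr (rintZ (2 * jap x ^+ b) ir)) => w; rewrite ger0_norm //.
split => //; apply: le_trans (rI_le irr (rintZ (2 * jap x ^+ b) ir) le_r) _.
by rewrite rIZ // rE -mulrA -exprD -nE.
Qed.

(** The integral formula of the orthogonal projection onto H_n. Applied to F = f h it is the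
    Toeplitz operator with symbol f, that is, n + 1 times [Rstar n f h] ([RstarE]). *)
Definition toep n F x := iota_int n (fun w => F w * (1 + x * w^*) ^+ n).

Lemma cint_toep n F x : adm 0 n F ->
  cint (fun w => F w * (1 + x * w^*) ^+ n * (iota_dens n w)%:C).
Proof.
move=> aF; apply: adm_cint.
apply: admW (admM (admM aF (admX n (adm_kerr x))) (adm_dens n)); lia.
Qed.

Lemma toepD n F G x : adm 0 n F -> adm 0 n G ->
  toep n (fun w => F w + G w) x = toep n F x + toep n G x.
Proof.
move=> aF aG; rewrite /toep /iota_int -cintAD; [|exact: cint_toep..].
by apply: eq_cintA => w; ring.
Qed.

Lemma toepZ n F c x : adm 0 n F -> toep n (fun w => c * F w) x = c * toep n F x.
Proof.
move=> aF; rewrite /toep /iota_int -cintAZ; last exact: cint_toep.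
by apply: eq_cintA => w; ring.
Qed.

Lemma eq_toep n F G x : F =1 G -> toep n F x = toep n G x.
Proof. by move=> /funext ->. Qed.

(** The constant 4 is the 2 of [cnorm_cintA_le] times the 2 of [schur_bound]; it does not depend on
    n. *)
Lemma toep_bound n F B x : adm 0 n F -> 0 <= B ->
  (forall w, cnorm (F w) <= B * jap w ^+ n) ->
  cnorm (toep n F x) <= 4 * B * jap x ^+ n.
Proof.
move=> aF B0 hB; have [ir rE] := schur_bound n x.
apply: le_trans (cnorm_cintA_le (cint_toep x aF) (rintZ B ir) _) _.
  move=> w; rewrite !cnormM cnormX cnorm_real ger0_norm ?iota_dens_ge0 // mulrA.
  apply: ler_wpM2r; first exact: iota_dens_ge0.
  rewrite mulrCA mulrC; apply: ler_wpM2l (hB w).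
  by rewrite exprn_ge0 // cnorm_ge0.
rewrite rIZ // -mulrA; apply: le_trans (_ : 2 * (B * (2 * jap x ^+ n)) <= _).
  by rewrite ler_wpM2l // ler_wpM2l.
by rewrite le_eqVlt; apply/orP; left; apply/eqP; ring.
Qed.

Lemma adm_sum p q k (G : 'I_k -> R[i] -> R[i]) : (p <= q)%N ->
  (forall i, adm p q (G i)) -> adm p q (fun w => \sum_(i < k) G i w).
Proof.
move=> le; elim: k G => [|k IH] G aG.
  apply: (@adm_eq _ _ _ (fun=> 0)) => [w|]; first by rewrite big_ord0.
  by apply: admW (adm_cst 0); rewrite add0n addn0.
apply: (@adm_eq _ _ _ (fun w => G ord0 w + \sum_(i < k) G (lift ord0 i) w)) => [w|].
  by rewrite big_ord_recl.
by apply: admD => //; apply: IH.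
Qed.

(** Binomial expansion of the kernel exhibits a polynomial of degree at most n with the integrals
    [c i] in its coefficients. The class [adm 0 n] is thus stable and the operator can be
    iterated. *)
Lemma adm_toep n F : adm 0 n F -> adm 0 n (toep n F).
Proof.
move=> aF.
pose c (i : 'I_n.+1) := cintA (fun w => F w * w^* ^+ i * (iota_dens n w)%:C).
have ic (i : 'I_n.+1) : cint (fun w => F w * w^* ^+ i * (iota_dens n w)%:C).
  have li := ltn_ord i; apply: adm_cint.
  apply: admW (admM (admM aF (admX i (adm_conj (adm_id R)))) (adm_dens n)); lia.
apply: (@adm_eq _ _ _ (fun x => \sum_(i < n.+1) ('C(n, i)%:R * c i) * x ^+ i)).
  move=> x; rewrite /toep /iota_int.
  rewrite (@eq_cintA _ _ (fun w => \sum_(i < n.+1) ('C(n, i)%:R * x ^+ i) *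
    (F w * w^* ^+ i * (iota_dens n w)%:C))); last first.
    move=> w; rewrite exprDn mulr_sumr mulr_suml; apply: eq_bigr => i _.
    by rewrite expr1n mul1r exprMn -mulr_natr; ring.
  rewrite cintA_sum => [|i]; last exact: cintZ.
  by apply: eq_bigr => i _; rewrite cintAZ // /c; ring.
apply: adm_sum => // i; apply: admZ; apply: admW (admX i (adm_id R)).
by have := ltn_ord i; lia.
Qed.

Lemma adm_Kern n z : adm 0 n (Kern n z).
Proof. by have := admX n (adm_kerl z); rewrite muln0 muln1. Qed.

Lemma toep_Kern n z x : toep n (Kern n z) x = Kern n z x.
Proof. exact: reproducing. Qed.

Lemma RstarE n f h : Rstar n f h = fun x => (n.+1%:R)^-1 * toep n (fun w => f w * h w) x.
Proof. by []. Qed.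

End Toeplitz.

(** * Boundedness and chordal uniform continuity of the symbol *)

Section UniformContinuity.
Variable R : realType.
Implicit Types (z w x : R[i]) (f : R[i] -> R[i]).

Lemma cpxK z : cpx (complex.Re z, complex.Im z) = z.
Proof. by case: z. Qed.

Lemma cpx_ball (p q : R * R) (d : R) : ball p d q -> cnorm (cpx q - cpx p) < 2 * d.
Proof.
move=> [/= h1 h2]; rewrite /ball /= in h1 h2.
apply: le_lt_trans (cnorm_le_ReIm _) _; rewrite /=.
by rewrite distrC [X in _ + X]distrC; lra.
Qed.

Lemma contCP1_ccont f : contCP1 f -> ccont f.
Proof.
move=> [cf _].
have key (p : R * R) (e : R) : 0 < e ->
    \forall q \near p, cnorm (f (cpx q) - f (cpx p)) < e.
  move=> e0; have [d [d0 hd]] := cf (cpx p) e e0.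
  apply/nbhs_ballP; exists (d / 2) => /=; first by rewrite divr_gt0.
  by move=> q /cpx_ball hq; apply: hd; apply: lt_le_trans hq _; rewrite mulrC divfK.
split => p; apply/cvgrPdist_lt => e e0; apply: filterS (key p e e0) => q h;
  rewrite distrC; apply: le_lt_trans h.
  by apply: le_trans (Re_le_cnorm _); case: (f _); case: (f _).
by apply: le_trans (Im_le_cnorm _); case: (f _); case: (f _).
Qed.

Definition box (M : R) : set (R * R) := `[- M, M]%classic `*` `[- M, M]%classic.

Lemma compact_box M : compact (box M).
Proof. by apply: compact_setX; exact: segment_compact. Qed.

Lemma cnorm_box M z : cnorm z <= M -> box M (complex.Re z, complex.Im z).
Proof.
move=> h; have := le_trans (Re_le_cnorm z) h; have := le_trans (Im_le_cnorm z) h.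
by rewrite !ler_norml => h1 h2; split; rewrite /= in_itv.
Qed.

(** Near infinity f is within 1 of its limit, and the extreme value theorem covers a box. The bound
    is at least 1 so that it can be divided by. *)
Lemma contCP1_bounded f : contCP1 f -> exists2 M : R, 1 <= M & forall z, cnorm (f z) <= M.
Proof.
move=> cf; have ccf := contCP1_ccont cf; have [_ [L hL]] := cf.
have [M0 hM] := hL 1 ltr01.
(* The threshold may be negative; the maximum keeps the box nonempty. *)
pose M1 := Num.max M0 0.
have b0 : box M1 !=set0.
  by exists (0, 0); split; rewrite /= in_itv /= oppr_le0 le_max lexx orbT.
have cw : {within box M1, continuous (fun p : R * R => cnorm (f (cpx p)))}.
  by apply: continuous_subspaceT; exact: rcont_cnorm.
have [c _ hc] := compact_EVT_max b0 (@compact_box M1) cw.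
exists (1 + cnorm L + cnorm (f (cpx c))) => [|z].
  by rewrite -addrA lerDl addr_ge0 // cnorm_ge0.
have [h|h] := leP (cnorm z) M1.
  have := hc _ (mem_set (cnorm_box h)); rewrite cpxK => h'.
  by apply: le_trans h' _; rewrite lerDr addr_ge0 // cnorm_ge0.
have := hM z; rewrite (le_lt_trans _ h) ?le_max ?lexx // => /(_ isT) h'.
have := cnormD (f z - L) L; rewrite subrK; have := cnorm_ge0 (f (cpx c)).
by move: h'; lra.
Qed.

(** Heine-Cantor through the near-covering form of compactness. Only z is confined; w may leave the
    disc. *)
Lemma contCP1_unif_box f M e : contCP1 f -> 0 < e -> exists2 d : R, 0 < d &
  forall z w, cnorm z <= M -> cnorm (w - z) < d -> cnorm (f w - f z) < e.
Proof.
move=> [cf _] e0.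
pose P (d : R) (p : R * R) := forall w, cnorm (w - cpx p) < d -> cnorm (f w - f (cpx p)) < e.
have H : \forall d \near 0^'+, box M `<=` P d.
  apply: (iffLR (compact_near_coveringP _) (@compact_box M)) => p _.
  have [d [d0 hd]] := cf (cpx p) (e / 2) ltac:(lra).
  have d4 : 0 < d / 4 by lra.
  (* [cpx_ball] turns radius d / 4 into a modulus below d / 2, so a point within t < d / 2 of
     [cpx q] lies within d of [cpx p]. *)
  exists (ball p (d / 4), [set t | t < d / 2]).
    split => /=; first exact: nbhsx_ballx.
    by apply: nbhs_right_lt; lra.
  move=> [q t] [/= /cpx_ball hq ht] w hw.
  have h1 : cnorm (f w - f (cpx p)) < e / 2.
    apply: hd; have -> : w - cpx p = (w - cpx q) + (cpx q - cpx p) by ring.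
    by apply: le_lt_trans (cnormD _ _) _; lra.
  have h2 : cnorm (f (cpx q) - f (cpx p)) < e / 2 by apply: hd; lra.
  have -> : f w - f (cpx q) = (f w - f (cpx p)) - (f (cpx q) - f (cpx p)) by ring.
  by apply: le_lt_trans (cnormB _ _) _; lra.
have [d [d0 hd]] := filter_ex (filterI (nbhs_right_gt (0 : R)) H).
exists d => // z w hz hw.
by have := hd _ (cnorm_box hz) w; rewrite cpxK; exact.
Qed.

Lemma cnorm_sub_sym z w : cnorm (z - w) = cnorm (w - z).
Proof. by rewrite -cnormN opprB. Qed.

(** Uniform continuity on the sphere. If z or w has modulus at most M, chordal closeness forces
    Euclidean closeness and [contCP1_unif_box] applies; otherwise both values are within e / 2 of
    the limit at infinity. *)
Lemma contCP1_chordal f e : contCP1 f -> 0 < e -> exists2 d : R, 0 < d < 1 &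
  forall z w, cnorm (w - z) ^+ 2 < d * (jap w * jap z) ^+ 2 -> cnorm (f w - f z) < e.
Proof.
move=> cf e0; have [_ [L hL]] := cf.
have [M0 hM] := hL (e / 2) ltac:(lra).
pose M := Num.max M0 0.
have M0' : 0 <= M by rewrite le_max lexx orbT.
have [t t0 ht] := contCP1_unif_box M cf e0.
pose A := (1 + M ^+ 2) * (1 + 2 * M ^+ 2).
have M2 : 0 <= M ^+ 2 by exact: sqr_ge0.
have A1 : 1 + M ^+ 2 <= A by rewrite /A; nra.
have A0 : 0 < A by lra.
(* For u = |w - z|^2 and |z| <= M, chordal closeness gives u < d A + 2 u d (1 + M^2). The two bounds
   on d make this at most t^2 / 4 + u / 2, hence u < t^2. *)
pose d := Num.min (4 * A)^-1 (t ^+ 2 / (4 * A)).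
have d0 : 0 < d by rewrite lt_min invr_gt0 divr_gt0 ?exprn_gt0 // mulr_gt0.
have dA : d * A <= 4^-1.
  apply: le_trans (_ : (4 * A)^-1 * A <= _).
    by rewrite ler_wpM2r ?(ltW A0) // ge_min lexx.
  by rewrite invfM -mulrA mulVf ?mulr1 // lt0r_neq0.
have dt : d * A <= t ^+ 2 / 4.
  apply: le_trans (_ : t ^+ 2 / (4 * A) * A <= _).
    by rewrite ler_wpM2r ?(ltW A0) // ge_min lexx orbT.
  by rewrite -mulrA invfM -[4^-1 * _ * _]mulrA mulVf ?mulr1 // lt0r_neq0.
have d1 : d < 1 by nra.
have near1 z w : cnorm z <= M -> cnorm (w - z) ^+ 2 < d * (jap w * jap z) ^+ 2 ->
    cnorm (w - z) < t.
  move=> hz; rewrite exprMn !jap_sqr -!cnorm_sqr => h.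
  have n0 := cnorm_ge0 (w - z); have nz := cnorm_ge0 z.
  have z2 : cnorm z ^+ 2 <= M ^+ 2 by rewrite ler_sqr ?nnegrE.
  have w2 : cnorm w ^+ 2 <= 2 * M ^+ 2 + 2 * cnorm (w - z) ^+ 2.
    have := cnormD (w - z) z; rewrite subrK => h1; have := cnorm_ge0 w => w0.
    by have := sqr_ge0 (cnorm (w - z) - cnorm z); nra.
  set u := cnorm (w - z) ^+ 2 in h w2 *.
  have u0 : 0 <= u by exact: sqr_ge0.
  have h2 : u < d * ((1 + 2 * M ^+ 2 + 2 * u) * (1 + M ^+ 2)).
    apply: lt_le_trans h _; rewrite ler_wpM2l ?(ltW d0) //.
    by apply: ler_pM; have := sqr_ge0 (cnorm w); have := sqr_ge0 (cnorm z); lra.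
  have h3 : u < t ^+ 2.
    have h4 : d * ((1 + 2 * M ^+ 2 + 2 * u) * (1 + M ^+ 2)) =
      d * A + 2 * u * (d * (1 + M ^+ 2)) by rewrite /A; ring.
    have h5 : d * (1 + M ^+ 2) <= 4^-1.
      by apply: le_trans dA; rewrite ler_wpM2l // ltW.
    have h6 : 2 * u * (d * (1 + M ^+ 2)) <= 2 * u * 4^-1 by rewrite ler_wpM2l // mulr_ge0.
    have t2 : 0 < t ^+ 2 by rewrite exprn_gt0.
    by move: h2; rewrite h4; lra.
  by rewrite -(@ltr_pXn2r _ 2) ?nnegrE // ltW.
exists d; first by rewrite d0 d1.
move=> z w h.
have [hz|hz] := leP (cnorm z) M; first by apply: ht => //; exact: near1.
have [hw|hw] := leP (cnorm w) M.
  rewrite cnorm_sub_sym; apply: ht => //; apply: near1 => //.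
  by rewrite cnorm_sub_sym [jap z * _]mulrC.
have L1 : M0 <= M by rewrite le_max lexx.
have := hM z (le_lt_trans L1 hz); have := hM w (le_lt_trans L1 hw) => a b.
have -> : f w - f z = (f w - L) - (f z - L) by ring.
by apply: le_lt_trans (cnormB _ _) _; lra.
Qed.

End UniformContinuity.

(** * Approximate eigenfunctions and the limit of the Berezin symbols *)

Section BerezinLimit.
Variable R : realType.
Local Notation "x %:C" := (real_complex R x) (format "x %:C") : ring_scope.
Variable f : R[i] -> R[i].
Hypothesis cf : contCP1 f.
Implicit Types (z w x : R[i]).

Lemma adm_symbol : adm 0 0 f.
Proof.
split; first exact: contCP1_ccont.
have [M M1 hM] := contCP1_bounded cf.
by exists M => [|w]; [exact: le_trans M1|rewrite expr0 !mulr1].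
Qed.

Lemma adm_symbolM n h : adm 0 n h -> adm 0 n (fun w => f w * h w).
Proof. exact: admM adm_symbol. Qed.

Lemma adm_symbolB n z : adm 0 n (fun w => (f w - f z) * Kern n z w).
Proof.
have aB : adm 0 0 (fun w => f w - f z) by apply: admD; [exact: adm_symbol|exact: adm_cst].
exact: admM aB (adm_Kern n z).
Qed.

(** A pointwise bound on the integrand suffices, by [toep_bound]. Chordally close to z the
    difference f(w) - f(z) is small; elsewhere it is at most 2 M, and [kernel_chordal] bounds the
    kernel by q^n (jap w jap z)^n with q = sqrt (1 - d) < 1. *)
Lemma toep_localize e : 0 < e -> exists N, forall n z x, (N <= n)%N ->
  cnorm (toep n (fun w => (f w - f z) * Kern n z w) x) <= e * (jap x ^+ n * jap z ^+ n).
Proof.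
move=> e0; have [M M1 hM] := contCP1_bounded cf.
have M0 : 0 < M by exact: lt_le_trans M1.
(* [toep_bound] costs a factor 4, which leaves e / 4, split as e / 8 for each region. *)
have [d /andP[d0 d1] hd] := contCP1_chordal cf (ltac:(lra) : 0 < e / 8).
pose q := Num.sqrt (1 - d).
have q0 : 0 <= q by exact: sqrtr_ge0.
have q2 : q ^+ 2 = 1 - d by rewrite sqr_sqrtr //; lra.
have q1 : q < 1 by rewrite -(@ltr_pXn2r _ 2) ?nnegrE // q2 expr1n; lra.
have qc : (GRing.exp q : nat -> R) @ \oo --> (0 : R) by apply: cvg_expr; rewrite ger0_norm.
(* Chosen so that 2 M q^n is at most e / 8. *)
have e16 : 0 < e / (16 * M) by rewrite divr_gt0 // mulr_gt0.
have [N _ hN] := (iffLR (cvgrPdist_lt _ _) qc) _ e16.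
exists N => n z x leN.
have qn : q ^+ n < e / (16 * M).
  by have := hN n leN; rewrite sub0r normrN ger0_norm // exprn_ge0.
have qM : 2 * M * q ^+ n <= e / 8.
  move: qn; rewrite ltr_pdivlMr ?mulr_gt0 //; set Q := q ^+ n; lra.
pose B := e / 4 * jap z ^+ n.
have jz n' : 0 <= jap z ^+ n' by rewrite exprn_ge0 // jap_ge0.
have jw w n' : 0 <= jap w ^+ n' by rewrite exprn_ge0 // jap_ge0.
have B0 : 0 <= B by rewrite mulr_ge0 // ltW // divr_gt0.
have -> : e * (jap x ^+ n * jap z ^+ n) = 4 * B * jap x ^+ n by rewrite /B; field.
apply: toep_bound => //; first exact: adm_symbolB.
move=> w; rewrite cnormM cnormX.
have kb := kernel_le_jap z w.
have k0 := cnorm_ge0 (1 + w * z^*).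
have J0 : 0 <= jap w * jap z by rewrite mulr_ge0 // jap_ge0.
(* Each w lies in one region and uses one of the two summands; the other is merely nonnegative. *)
have -> : B * jap w ^+ n = e / 8 * (jap w * jap z) ^+ n + e / 8 * (jap w * jap z) ^+ n.
  by rewrite /B exprMn; field.
have [h|h] := ltP (cnorm (w - z) ^+ 2) (d * (jap w * jap z) ^+ 2).
  rewrite -[leLHS]addr0; apply: lerD.
    by apply: ler_pM; [exact: cnorm_ge0|exact: exprn_ge0|exact: ltW (hd _ _ h)|exact: lerXn2r].
  by rewrite mulr_ge0 ?exprn_ge0 // ltW // divr_gt0.
rewrite -[leLHS]add0r; apply: lerD.
  by rewrite mulr_ge0 ?exprn_ge0 // ltW // divr_gt0.
have kq : cnorm (1 + w * z^*) <= q * (jap w * jap z).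
  rewrite -(@ler_pXn2r _ 2) ?nnegrE ?mulr_ge0 ?jap_ge0 // exprMn q2.
  by have := kernel_chordal z w; move: h; set u := (_ * _) ^+ 2; lra.
apply: le_trans (_ : 2 * M * (q ^+ n * (jap w * jap z) ^+ n) <= _); last first.
  by rewrite mulrA ler_wpM2r // exprn_ge0.
rewrite -exprMn; apply: ler_pM; [exact: cnorm_ge0|exact: exprn_ge0| |].
  by apply: le_trans (cnormB _ _) _; have := hM w; have := hM z; lra.
by apply: lerXn2r; rewrite ?nnegrE ?mulr_ge0 ?jap_ge0.
Qed.

(** The value at x of T^m K_z - f(z)^m K_z; the factor (n + 1)^m turns powers of [Rstar] into powers
    of T. *)
Definition defect m n z x : R[i] :=
  n.+1%:R ^+ m * op_pow m (Rstar n f) (Kern n z) x - f z ^+ m * Kern n z x.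

Lemma adm_op_pow m n z : adm 0 n (op_pow m (Rstar n f) (Kern n z)).
Proof.
elim: m => [|m IH]; first exact: adm_Kern.
by rewrite /op_pow iterS RstarE; apply: admZ; apply: adm_toep; exact: adm_symbolM.
Qed.

Lemma adm_defect m n z : adm 0 n (defect m n z).
Proof.
apply: admD; first by apply: admZ; exact: adm_op_pow.
by apply: admN; apply: admZ; exact: adm_Kern.
Qed.

(** T^(m+1) K_z - f(z)^(m+1) K_z is T applied to the previous defect plus f(z)^m (T K_z - f(z) K_z).
    The last bracket is [toep] of (f - f(z)) K_z because [toep] fixes K_z. *)
Lemma defectS m n z x : defect m.+1 n z x =
  toep n (fun w => f w * defect m n z w) x +
  f z ^+ m * toep n (fun w => (f w - f z) * Kern n z w) x.
Proof.
have aK := adm_Kern n z; have aP := adm_op_pow m n z.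
have n0 : (n.+1%:R : R[i]) != 0 by rewrite pnatr_eq0.
have -> : toep n (fun w => f w * defect m n z w) x =
    n.+1%:R ^+ m * toep n (fun w => f w * op_pow m (Rstar n f) (Kern n z) w) x
    - f z ^+ m * toep n (fun w => f w * Kern n z w) x.
  rewrite -mulNr -!toepZ; [|exact: adm_symbolM..].
  rewrite -toepD; [|by apply: admZ; exact: adm_symbolM..].
  by apply: eq_toep => w; rewrite /defect; ring.
have -> : toep n (fun w => (f w - f z) * Kern n z w) x =
    toep n (fun w => f w * Kern n z w) x - f z * Kern n z x.
  rewrite -[in RHS]toep_Kern -mulNr -toepZ //.
  rewrite -toepD; [|exact: adm_symbolM|exact: admZ].
  by apply: eq_toep => w; ring.
rewrite /defect /op_pow iterS {1}RstarE exprS exprS.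
by rewrite mulrA [_ * n.+1%:R ^+ m]mulrC mulfK //; ring.
Qed.

(** Induction on m through [defectS]. The threshold depends on neither z nor x, which yields uniform
    convergence. *)
Lemma defect_small m e : 0 < e -> exists N, forall n z x, (N <= n)%N ->
  cnorm (defect m n z x) <= e * (jap x ^+ n * jap z ^+ n).
Proof.
have [M M1 hM] := contCP1_bounded cf.
have M0 : 0 < M by exact: lt_le_trans M1.
have j0 x n : 0 <= jap x ^+ n by rewrite exprn_ge0 // jap_ge0.
elim: m e => [|m IH] e e0.
  exists 0%N => n z x _; rewrite /defect /= !expr0 !mul1r subrr cnorm0.
  by rewrite !mulr_ge0 // ltW.
(* Multiplication by f costs M and [toep] costs 4, so this term contributes e / 2; the factor f(z)^m
   in the other costs M^m and leaves e / 2 as well. *)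
have [N1 h1] := IH (e / (8 * M)) ltac:(by rewrite divr_gt0 // mulr_gt0).
have [N2 h2] := @toep_localize (e / (2 * M ^+ m))
  ltac:(by rewrite divr_gt0 // mulr_gt0 // exprn_gt0).
exists (maxn N1 N2) => n z x; rewrite geq_max => /andP[l1 l2].
rewrite defectS; apply: le_trans (cnormD _ _) _.
have a : cnorm (toep n (fun w => f w * defect m n z w) x) <=
    e / 2 * (jap x ^+ n * jap z ^+ n).
  have -> : e / 2 * (jap x ^+ n * jap z ^+ n) = 4 * (e / 8 * jap z ^+ n) * jap x ^+ n by field.
  apply: toep_bound; first exact/adm_symbolM/adm_defect.
    by rewrite mulr_ge0 // ltW // divr_gt0.
  move=> w; rewrite cnormM.
  have -> : e / 8 * jap z ^+ n * jap w ^+ n = M * (e / (8 * M) * (jap w ^+ n * jap z ^+ n)).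
    by field; exact: lt0r_neq0.
  by apply: ler_pM; rewrite ?cnorm_ge0 // h1.
have b : cnorm (f z ^+ m * toep n (fun w => (f w - f z) * Kern n z w) x) <=
    e / 2 * (jap x ^+ n * jap z ^+ n).
  have -> : e / 2 * (jap x ^+ n * jap z ^+ n) =
      M ^+ m * (e / (2 * M ^+ m) * (jap x ^+ n * jap z ^+ n)).
    by field; rewrite expf_neq0 // lt0r_neq0.
  rewrite cnormM cnormX; apply: ler_pM; rewrite ?exprn_ge0 ?cnorm_ge0 //; last exact: h2.
  by apply: lerXn2r; rewrite ?nnegrE ?cnorm_ge0 // ltW.
by apply: le_trans (lerD a b) _; rewrite -mulrDl -splitr.
Qed.

(** On the diagonal K_z(z) is exactly the denominator of the Berezin symbol. *)
Lemma Rnu_defect m n z :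
  n.+1%:R ^+ m * Rnu n (op_pow m (Rstar n f)) z - f z ^+ m =
  defect m n z z / ((1 + abs2 z) ^+ n)%:C.
Proof.
have K : Kern n z z = ((1 + abs2 z) ^+ n)%:C.
  by rewrite /Kern -abs2E -(rmorph1 (real_complex R)) -rmorphD /= -rmorphXn.
have k0 : ((1 + abs2 z) ^+ n)%:C != 0 :> R[i].
  by rewrite (fmorph_eq0 (real_complex R)) expf_neq0 // lt0r_neq0 // oneDabs2_gt0.
by rewrite /defect /Rnu /op_kernel K mulrBl mulfK // mulrA.
Qed.

Lemma supnorm_Rnu_cvg m :
  (fun n : nat => supnorm (fun z => n.+1%:R ^+ m * Rnu n (op_pow m (Rstar n f)) z - f z ^+ m))
    @ \oo --> (0 : R).
Proof.
apply/cvgrPdist_le => e e0; have [N hN] := defect_small m e0.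
exists N => // n /= leN; rewrite sub0r normrN /supnorm.
set S := (X in sup X).
(* At x = z the weight [jap z ^+ n * jap z ^+ n] equals (1 + |z|^2)^n and cancels the
   denominator. *)
have ub : ubound S e.
  move=> _ [z _ <-]; rewrite Rnu_defect cnormM -fmorphV /= cnorm_real normfV ger0_norm; last first.
    by rewrite exprn_ge0 // ltW // oneDabs2_gt0.
  rewrite ler_pdivrMr ?exprn_gt0 ?oneDabs2_gt0 //.
  by have := hN n z z leN; rewrite -exprMn -expr2 jap_sqr.
(* Nonemptiness together with the bound e makes [sup S] a genuine supremum rather than a default
   value. *)
have S0 : S !=set0 by exists (cnorm (n.+1%:R ^+ m * Rnu n (op_pow m (Rstar n f)) 0 - f 0 ^+ m)); exists 0.
rewrite ger0_norm; first exact: ge_sup.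
have [s Ss] := S0; apply: le_trans (ub_le_sup _ Ss); last by exists e.
by case: Ss => z _ <-; exact: cnorm_ge0.
Qed.

End BerezinLimit.

Theorem mainTheorem8 (R : realType) (f : R[i] -> R[i]) (n : nat) :
  contCP1 f -> (0 < n)%N ->
  (fun nu : nat =>
     supnorm (fun z => ((nu.+1)%:R) ^+ n * Rnu nu (op_pow n (Rstar nu f)) z - f z ^+ n))
    @ \oo --> (0 : R).
Proof. by move=> cf _; exact: supnorm_Rnu_cvg. Qed.
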